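(* (1) Let $U\subseteq\mathscr H$ be open and let $\varphi$ be a nowhere vanishing holomorphic function on $U$ satisfying $\Delta_b\varphi=0$. Then the connection form $$\Phi=\begin{bmatrix}\frac12(\mathrm d_0\ln\varphi-\mathrm d_1\ln\varphi) & V_{01'}(\ln\varphi)\,\theta^{00'}+V_{11'}(\ln\varphi)\,\theta^{10'}\\ V_{00'}(\ln\varphi)\,\theta^{01'}+V_{10'}(\ln\varphi)\,\theta^{11'} & -\frac12(\mathrm d_0\ln\varphi-\mathrm d_1\ln\varphi)\end{bmatrix}+\Phi_T\theta$$ is ASD (for any $\mathfrak{gl}(2,\mathbb{C})$-valued holomorphic function $\Phi_T$ on $U$). (2) In particular, $$\varphi:=\frac{1}{\|\mathbf y\|^4-t^2},\qquad \|\mathbf y\|^2=\det\begin{bmatrix}y_{00'}&y_{01'}\\ y_{10'}&y_{11'}\end{bmatrix},$$ is a solution of $\Delta_b\varphi=0$ on $\mathscr H\setminus\{\|\mathbf y\|^4=t^2\}$.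
   Context: $\mathscr H=\mathbb{C}^5$ is the complex Heisenberg group with coordinates $(y_{00'},y_{10'},y_{01'},y_{11'},t)$ and left invariant vector fields $V_{00'}=\partial_{y_{00'}}-y_{11'}T$, $V_{01'}=\partial_{y_{01'}}+y_{10'}T$, $V_{10'}=\partial_{y_{10'}}-y_{01'}T$, $V_{11'}=\partial_{y_{11'}}+y_{00'}T$, $T=\partial_t$. The $1$-forms $\{\theta^{00'},\theta^{10'},\theta^{01'},\theta^{11'},\theta\}$ are dual to $\{V_{00'},V_{10'},V_{01'},V_{11'},T\}$. Sub-Laplacian: $\Delta_b=V_{00'}V_{11'}-V_{10'}V_{01'}$. Partial exterior differentials of a function: $\mathrm d_0f=V_{00'}f\,\theta^{00'}+V_{10'}f\,\theta^{10'}$, $\mathrm d_1f=V_{01'}f\,\theta^{01'}+V_{11'}f\,\theta^{11'}$. Here $V\ln\varphi=\varphi^{-1}V\varphi$. A matrix-valued connection form $\Phi=\sum_{A,A'}\Phi_{AA'}\theta^{AA'}+\Phi_T\theta$ is ASD if its curvature $F=\mathrm d\Phi+\Phi\wedge\Phi$ satisfies $F(V_0,V_1)=0$ for all $0\neq(\pi_{0'},\pi_{1'})\in\mathbb{C}^2$, where $V_A=\pi_{0'}V_{A0'}-\pi_{1'}V_{A1'}$, $A=0,1$ (i.e. it is flat on every integral surface of $\mathrm{span}\{V_0,V_1\}$). Equivalently, $$V_{00'}(\Phi_{10'})-V_{10'}(\Phi_{00'})+[\Phi_{00'},\Phi_{10'}]=0,$$ $$V_{01'}(\Phi_{10'})+V_{00'}(\Phi_{11'})-V_{10'}(\Phi_{01'})-V_{11'}(\Phi_{00'})+[\Phi_{00'},\Phi_{11'}]+[\Phi_{01'},\Phi_{10'}]=0,$$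 $$V_{01'}(\Phi_{11'})-V_{11'}(\Phi_{01'})+[\Phi_{01'},\Phi_{11'}]=0.$$ *)

(* Defs.v *)
From mathcomp Require Import all_boot all_order all_algebra.
From mathcomp Require Import complex.
From mathcomp Require Import all_classical all_reals all_analysis.

Set Implicit Arguments.
Unset Strict Implicit.
Unset Printing Implicit Defensive.

Import Order.TTheory GRing.Theory Num.Theory.
Import numFieldNormedType.Exports.

Local Open Scope classical_set_scope.
Local Open Scope ring_scope.

(* [R[i]] is sealed behind a [numClosedFieldType] so that the normed-module
   instances of [numFieldNormedType] apply to it; topology, [differentiable]
   and ['D_v] below are therefore those over the complex field. *)
Definition Cplx (R : realType) : numClosedFieldType := R[i]%C.

(* Coordinates are ordered as (y00', y10', y01', y11', t). *)
Definition heis (R : realType) := 'rV[Cplx R]_5.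

Section Heisenberg.
Context {R : realType}.
Local Notation C := (Cplx R).
Local Notation H := 'rV[Cplx R]_5.
Local Notation M2 := 'M[Cplx R]_2.

Definition y00 (p : H) : C := p 0 0.
Definition y10 (p : H) : C := p 0 1.
Definition y01 (p : H) : C := p 0 2.
Definition y11 (p : H) : C := p 0 3.
Definition tcoord (p : H) : C := p 0 4.

(* Complex Frechet differentiability at every point; meant for [U] open. *)
Definition holomorphic_on (W : normedModType C) (U : set H) (f : H -> W) :=
  forall p, U p -> differentiable f p.

(* A vector field is given by its coefficients in the coordinate frame; it
   acts on functions by differentiation along its value at the point. *)
Definition vfield := H -> H.

Definition act (W : normedModType C) (X : vfield) (f : H -> W) (p : H) : W :=
  'D_(X p) f p.

Definition dcoord (k : 'I_5) : H := delta_mx 0 k.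

Definition VT : vfield := fun _ => dcoord 4.
Definition V00 : vfield := fun p => dcoord 0 - y11 p *: VT p.
Definition V10 : vfield := fun p => dcoord 1 - y01 p *: VT p.
Definition V01 : vfield := fun p => dcoord 2 + y10 p *: VT p.
Definition V11 : vfield := fun p => dcoord 3 + y00 p *: VT p.

Definition sublaplacian (f : H -> C) (p : H) : C :=
  act V00 (act V11 f) p - act V10 (act V01 f) p.

(* [w p v] is the value of the form [w] at the point [p] on the vector [v]. *)
Definition form1 (W : Type) := H -> H -> W.
Definition form2 (W : Type) := H -> H -> H -> W.

Definition th00 : form1 C := fun _ v => v 0 0.
Definition th10 : form1 C := fun _ v => v 0 1.
Definition th01 : form1 C := fun _ v => v 0 2.
Definition th11 : form1 C := fun _ v => v 0 3.
(* dt + y11' dy00' + y01' dy10' - y10' dy01' - y00' dy11' *)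
Definition theta : form1 C := fun p v =>
  v 0 4 + y11 p * v 0 0 + y01 p * v 0 1 - y10 p * v 0 2 - y00 p * v 0 3.

Definition frame (i : 'I_5) : vfield := tnth [tuple V00; V10; V01; V11; VT] i.
Definition coframe (i : 'I_5) : form1 C :=
  tnth [tuple th00; th10; th01; th11; theta] i.

Lemma coframe_dual (i j : 'I_5) (p : H) : coframe i p (frame j p) = (i == j)%:R.
Proof.
rewrite /coframe /frame !(tnth_nth (fun _ => 0)) /=.
case: i => [] [|[|[|[|[|//]]]]] ?; case: j => [] [|[|[|[|[|//]]]]] ? /=;
  rewrite /th00 /th10 /th01 /th11 /theta ?/V00 ?/V10 ?/V01 ?/V11 ?/VT /dcoord;
  rewrite !mxE /= ?(mulr0, mulr1, addr0, add0r, subr0, oppr0, subrr, addNr) //.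
Qed.

(* For constant vectors [u] and [v], whose bracket vanishes:
   dw(u,v) = u(w(v)) - v(w(u)). *)
Definition extd (W : normedModType C) (w : form1 W) : form2 W := fun p u v =>
  'D_u (fun q => w q v) p - 'D_v (fun q => w q u) p.

Definition wedge_mx (a b : form1 M2) : form2 M2 := fun p u v =>
  a p u *m b p v - a p v *m b p u.

Definition curvature (Phi : form1 M2) : form2 M2 := fun p u v =>
  extd Phi p u v + wedge_mx Phi Phi p u v.

Definition VA0 (pi0 pi1 : C) : vfield := fun p => pi0 *: V00 p - pi1 *: V01 p.
Definition VA1 (pi0 pi1 : C) : vfield := fun p => pi0 *: V10 p - pi1 *: V11 p.

Definition ASD (U : set H) (Phi : form1 M2) : Prop :=
  forall pi0 pi1 : C, (pi0, pi1) != (0, 0) ->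
  forall p, U p -> curvature Phi p (VA0 pi0 pi1 p) (VA1 pi0 pi1 p) = 0.

(* V ln phi is by convention phi^-1 V phi: no logarithm is chosen. *)
Definition act_ln (X : vfield) (phi : H -> C) (p : H) : C :=
  (phi p)^-1 * act X phi p.

Definition d0_ln (phi : H -> C) : form1 C := fun p v =>
  act_ln V00 phi p * th00 p v + act_ln V10 phi p * th10 p v.
Definition d1_ln (phi : H -> C) : form1 C := fun p v =>
  act_ln V01 phi p * th01 p v + act_ln V11 phi p * th11 p v.

Definition mx22 (a b c d : C) : M2 :=
  \matrix_(i, j) if i == 0 then (if j == 0 then a else b)
                 else (if j == 0 then c else d).

Definition ansatz (phi : H -> C) (PhiT : H -> M2) : form1 M2 := fun p v =>
  mx22
    (2^-1 * (d0_ln phi p v - d1_ln phi p v))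
    (act_ln V01 phi p * th00 p v + act_ln V11 phi p * th10 p v)
    (act_ln V00 phi p * th01 p v + act_ln V10 phi p * th11 p v)
    (- (2^-1 * (d0_ln phi p v - d1_ln phi p v)))
  + theta p v *: PhiT p.

Definition normsq (p : H) : C := \det (mx22 (y00 p) (y01 p) (y10 p) (y11 p)).

Definition fundsol (p : H) : C := 1 / (normsq p ^+ 2 - tcoord p ^+ 2).

End Heisenberg.

(* Main.v *)
(* The curvature of the ansatz involves second derivatives of [phi], and the ansatz is ASD
   only because derivatives along constant vectors commute, whereas complex Frechet
   differentiability of [phi] is all that is assumed. Hence the need for Cauchy's theory:
   Goursat's bisection gives local primitives; if [F' = f] then
   [K(r) = oint F(w + r z) / z^2 dz] satisfies [r K'(r) = K(r)], so that
   [oint F(w + r z) / z^2 dz = 2 pi i r f(w)], and differentiating this in [w] yields the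
   same formula for the pair [f], [f']. In several variables the formula expresses
   [D_v phi] as an integral of [phi]; differentiating it along [u] under the integral sign
   shows that [D_u D_v phi] exists and is an integral of [D_u phi], which by the formula is
   [D_v D_u phi].
   The frame fields then commute except for [V00', V11'] = [V10', V01'] = 2T. Together with
   [Delta_b phi = 0] this gives V00' V11' phi = V10' V01' phi and
   V11' V00' phi = V01' V10' phi, and the vanishing of the curvature becomes a rational
   identity. *)
Require Import Defs.
From mathcomp Require Import all_boot all_order all_algebra.
From mathcomp Require Import ring lra.
From mathcomp Require Import complex.
From mathcomp Require Import all_classical all_reals all_analysis.
Import Order.TTheory GRing.Theory Num.Theory.
Import numFieldNormedType.Exports.
Local Open Scope classical_set_scope.
Local Open Scope ring_scope.

Set Implicit Arguments.
Unset Strict Implicit.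
Unset Printing Implicit Defensive.

(** [Cplx R] is not a normed module over [R], so real parameters and complex values meet only
    through [toC], [ReC] and [ImC]. Derivatives are compared through an estimate without quotients,
    which survives such a change of scalars. The contour is the square with vertices 1, i, -1, -i,
    because segments need only integrals over the unit interval. The number 2 pi i is [oint_inv];
    its value never enters, only that it is nonzero, so that the formula can be solved for the
    derivative. The formula for a pair [F], [F' = f] requires [f] to be continuous. For the pair
    [f], [f'] that is not known beforehand, whence the detour through a primitive of [f]. The same
    obstacle returns in several variables: continuity of ['D_v phi] is extracted from the formula
    before anything is differentiated under the integral sign, and linearity of ['D_u ('D_v phi)] in
    [u] comes from symmetry, since only directional derivatives of ['D_v phi] are at hand. The term
    [PhiT] drops out because [theta] vanishes on both vectors and its exterior derivative vanishes
    on the pair. *)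

Lemma is_derive_epsP (K : numFieldType) (V W : normedModType K) (f : V -> W)
    (x v : V) (l : W) :
  is_derive x v f l <-> forall e : K, 0 < e ->
    \forall h \near (0 : K), `|f (x + h *: v) - f x - h *: l| <= e * `|h|.
Proof.
split=> [[df <-] e e0|H].
  have /cvgrPdist_lt /(_ e e0) : h^-1 *: ((f \o shift x) (h *: v) - f x)
      @[h --> 0^'] --> 'D_v f x := df.
  rewrite /dnbhs near_withinE => H; near=> h.
  have [->|h0] := eqVneq h 0.
    by rewrite !scale0r addr0 subrr subr0 !normr0 mulr0.
  have /(_ h0) : h != 0 -> `|'D_v f x - h^-1 *: (f (h *: v + x) - f x)| < e.
    by near: h.
  rewrite -(ltr_pM2r (x:=`|h|)) ?normr_gt0// => /ltW.
  rewrite [`|_| * `|h|]mulrC -normrZ scalerBr scalerA divff// scale1r.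
  by rewrite -normrN opprB [h *: v + x]addrC.
have lim : h^-1 *: ((f \o shift x) (h *: v) - f x) @[h --> 0^'] --> l.
  apply/cvgrPdist_le => e e0; have He := H e e0.
  rewrite /dnbhs near_withinE; near=> h => h0.
  rewrite -(ler_pM2r (x:=`|h|)) ?normr_gt0// [`|_| * `|h|]mulrC -normrZ scalerBr.
  rewrite scalerA divff// scale1r -normrN opprB /= [h *: v + x]addrC.
  by near: h.
split; first by apply/cvg_ex; exists l.
exact: cvg_lim.
Unshelve. all: by end_near.
Qed.

Lemma near_dist_lt (K : numFieldType) (V : normedModType K) (x : V) (e : K) :
  0 < e -> \forall t \near x, `|x - t| < e.
Proof. by move=> e0; apply/nbhs_normP; exists e. Qed.

Lemma continuous_atP (T : topologicalType) (K : numFieldType) (W : normedModType K)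
    (f : T -> W) (x : T) :
  {for x, continuous f} <->
  forall e : K, 0 < e -> \forall t \near x, `|f x - f t| < e.
Proof.
split; first by move=> /cvgrPdist_lt.
by move=> H; apply/cvgrPdist_lt.
Qed.

(** * Complex scalars and derivatives along real lines *)

Section ComplexScalars.
Variable R : realType.
Local Notation C := (Cplx R).
Implicit Types (x y : R) (z : C).

Definition toC x : C := (x%:C)%C.
Definition ReC z : R := complex.Re z.
Definition ImC z : R := complex.Im z.
Definition iC : C := ('i)%C.

Lemma toCD x y : toC (x + y) = toC x + toC y. Proof. exact: rmorphD. Qed.
Lemma toCB x y : toC (x - y) = toC x - toC y. Proof. exact: rmorphB. Qed.
Lemma toCM x y : toC (x * y) = toC x * toC y. Proof. exact: rmorphM. Qed.
Lemma toCV x : toC x^-1 = (toC x)^-1. Proof. exact: (fmorphV (real_complex R)). Qed.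
Lemma toC0 : toC 0 = 0. Proof. by []. Qed.
Lemma toC1 : toC 1 = 1. Proof. by []. Qed.
Lemma toC_nat n : toC n%:R = n%:R. Proof. exact: rmorph_nat. Qed.

Lemma ler_toC x y : (toC x <= toC y) = (x <= y). Proof. exact: lecR. Qed.
Lemma ltr_toC x y : (toC x < toC y) = (x < y). Proof. exact: ltcR. Qed.

Lemma toC_ge0 x : (0 <= toC x) = (0 <= x). Proof. exact: lecR. Qed.
Lemma toC_gt0 x : (0 < toC x) = (0 < x). Proof. exact: ltcR. Qed.

Lemma gt0_toC z : 0 < z -> z = toC (ReC z).
Proof. by case: z => a b; rewrite ltcE /= => /andP[/eqP -> _]. Qed.

Lemma gt0_ReC z : 0 < z -> 0 < ReC z.
Proof. by rewrite ltcE /= => /andP[]. Qed.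

Lemma norm_toC x : `|toC x| = toC `|x|.
Proof. by rewrite normc_def /= expr0n /= addr0 sqrtr_sqr. Qed.

Lemma ReCD z w : ReC (z + w) = ReC z + ReC w.
Proof. by case: z w => ? ? [? ?]. Qed.
Lemma ImCD z w : ImC (z + w) = ImC z + ImC w.
Proof. by case: z w => ? ? [? ?]. Qed.
Lemma ReCN z : ReC (- z) = - ReC z. Proof. by case: z. Qed.
Lemma ImCN z : ImC (- z) = - ImC z. Proof. by case: z. Qed.
Lemma ReCB z w : ReC (z - w) = ReC z - ReC w.
Proof. by rewrite ReCD ReCN. Qed.
Lemma ImCB z w : ImC (z - w) = ImC z - ImC w.
Proof. by rewrite ImCD ImCN. Qed.
Lemma ReCM z w : ReC (z * w) = ReC z * ReC w - ImC z * ImC w.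
Proof. by case: z w => ? ? [? ?]. Qed.
Lemma ImCM z w : ImC (z * w) = ReC z * ImC w + ImC z * ReC w.
Proof. by case: z w => ? ? [? ?]. Qed.
Lemma ReC_toC x : ReC (toC x) = x. Proof. by []. Qed.
Lemma ImC_toC x : ImC (toC x) = 0. Proof. by []. Qed.
Lemma ReC_toCM x z : ReC (toC x * z) = x * ReC z.
Proof. by rewrite ReCM /= mul0r subr0. Qed.
Lemma ImC_toCM x z : ImC (toC x * z) = x * ImC z.
Proof. by rewrite ImCM /= mul0r addr0. Qed.
Lemma ReC_iC : ReC iC = 0. Proof. by []. Qed.
Lemma ImC_iC : ImC iC = 1. Proof. by []. Qed.
Lemma CE z : z = toC (ReC z) + iC * toC (ImC z).
Proof. exact: complexE. Qed.

Lemma ler_norm_ReC z : toC `|ReC z| <= `|z|.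
Proof. by rewrite normc_def ler_toC -sqrtr_sqr ler_sqrt ?lerDl ?addr_ge0 ?sqr_ge0. Qed.
Lemma ler_norm_ImC z : toC `|ImC z| <= `|z|.
Proof. by rewrite normc_def ler_toC -sqrtr_sqr ler_sqrt ?lerDr ?addr_ge0 ?sqr_ge0. Qed.
Lemma norm_iC : `|iC| = 1.
Proof. by rewrite normc_def /= expr0n add0r expr1n sqrtr1. Qed.
Lemma ler_norm_ReIm z : `|z| <= toC (`|ReC z| + `|ImC z|).
Proof.
by rewrite {1}(CE z) (le_trans (ler_normD _ _))// normrM norm_iC mul1r !norm_toC -toCD.
Qed.

Lemma near_distC z (e : C) : 0 < e -> \forall t \near z, `|z - t| < e.
Proof. exact: (@near_dist_lt C C). Qed.

Lemma toC_continuous : continuous toC.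
Proof.
move=> x; apply/continuous_atP => e e0; rewrite (gt0_toC e0).
have : \forall t \near x, `|x - t| < ReC e.
  by apply: near_dist_lt; exact: gt0_ReC.
by apply: filterS => t; rewrite -toCB norm_toC ltr_toC.
Qed.

Lemma ReC_continuous : continuous ReC.
Proof.
move=> z; apply/continuous_atP => e e0.
have e0' : 0 < toC e by rewrite toC_gt0.
near=> w; rewrite -ReCB -ltr_toC; apply: le_lt_trans (ler_norm_ReC _) _.
by near: w; apply: near_distC.
Unshelve. all: by end_near.
Qed.

Lemma ImC_continuous : continuous ImC.
Proof.
move=> z; apply/continuous_atP => e e0.
have e0' : 0 < toC e by rewrite toC_gt0.
near=> w; rewrite -ImCB -ltr_toC; apply: le_lt_trans (ler_norm_ImC _) _.
by near: w; apply: near_distC.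
Unshelve. all: by end_near.
Qed.

Lemma is_derive_dir (f : C -> C) (z v l : C) :
  is_derive z 1 f l -> is_derive z v f (l * v).
Proof.
move=> [df <-].
have fz : differentiable f z by exact/derivable1_diffP.
split; first exact: diff_derivable.
by rewrite !deriveE// -[in LHS](mulr1 v) -[v * 1]/(v *: (1 : C)) linearZ/= mulrC.
Qed.

(** The complex estimate is used for real increments [toC h] only. Real and imaginary parts are
    bounded by the norm, so each inherits the estimate over [R]. *)
Lemma is_derive_line (V : normedModType C) (F : V -> C) (a v : V) (t : R) (l : C) :
  is_derive (a + toC t *: v) v F l ->
  is_derive t 1 (fun s : R => ReC (F (a + toC s *: v))) (ReC l) /\
  is_derive t 1 (fun s : R => ImC (F (a + toC s *: v))) (ImC l).
Proof.
move=> /is_derive_epsP H.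
have E (e : R) : 0 < e -> \forall h \near (0 : R),
    `|F (a + toC (t + h *: 1) *: v) - F (a + toC t *: v) - toC h *: l| <= toC (e * `|h|).
  move=> e0; have e0' : 0 < toC e by rewrite toC_gt0.
  have H0 : \forall h \near (0 : R), `|F (a + toC t *: v + toC h *: v) -
      F (a + toC t *: v) - toC h *: l| <= toC e * `|toC h| :=
    toC_continuous (H _ e0').
  apply: filterS H0 => h /=; rewrite toCM -norm_toC.
  by rewrite -[h *: 1]/(h * 1) mulr1 toCD scalerDl addrA.
split; apply/is_derive_epsP => e e0.
  apply: filterS (E e e0) => h.
  rewrite -ler_toC -ReCB -[h *: ReC l]ReC_toCM -ReCB.
  exact/le_trans/ler_norm_ReC.
apply: filterS (E e e0) => h.
rewrite -ler_toC -ImCB -[h *: ImC l]ImC_toCM -ImCB.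
exact/le_trans/ler_norm_ImC.
Qed.

End ComplexScalars.

(** * Integrals of complex functions over the unit interval *)

Section UnitIntervalIntegral.
Variable R : realType.
Local Notation C := (Cplx R).

Definition primitive01 (h g : R -> R) :=
  forall t : R, 0 <= t <= 1 -> is_derive t 1 g (h t).

(* [v] is the integral of [h] over [0, 1]. It is described by primitives of the real and
   imaginary parts because [Cplx R] is not a normed module over [R]. *)
Definition is_int01 (h : R -> C) (v : C) := exists g1 g2 : R -> R,
  [/\ primitive01 (fun t => ReC (h t)) g1, primitive01 (fun t => ImC (h t)) g2
    & v = toC (g1 1 - g1 0) + iC R * toC (g2 1 - g2 0)].

Lemma primitive01_bound (h g : R -> R) (M : R) : primitive01 h g ->
  (forall t, 0 <= t <= 1 -> `|h t| <= M) -> `|g 1 - g 0| <= M.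
Proof.
move=> hg hM; have [|||c] := @MVT_segment R g h 0 1.
- exact: ler01.
- by move=> t; rewrite in_itv /= => /andP[? ?]; apply: hg; rewrite !ltW.
- by apply: derivable_within_continuous => t; rewrite in_itv /= => /hg[].
by rewrite in_itv /= subr0 mulr1 => c01 ->; exact: hM.
Qed.

Lemma primitive01_exists (h : R -> R) :
  (forall t, 0 <= t <= 1 -> {for t, continuous h}) -> exists g, primitive01 h g.
Proof.
(* Extending [h] by its end values makes it continuous on the whole line. *)
move=> hc; pose clamp (t : R) := Num.min 1 (Num.max 0 t).
have clamp01 t : 0 <= clamp t <= 1.
  by rewrite /clamp le_min ler01 le_max lexx ge_min lexx.
have cclamp : continuous clamp.
  move=> t; apply: (@continuous_min R R (cst 1) (cst 0 \max id)).
    exact: cst_continuous.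
  by apply: (@continuous_max R R (cst 0) id); [exact: cst_continuous|exact: cvg_id].
have ch : continuous (h \o clamp).
  by move=> t; apply: continuous_comp; [exact: cclamp|exact/hc/clamp01].
(* The lower limit -1, and the upper end 2 below, make 0 and 1 interior points, as a two-sided
   derivative demands. *)
exists (fun x => \int[lebesgue_measure]_(t in `[-1, x]) (h \o clamp) t)%R => t /andP[t0 t1].
have [||||D1 D2] := @continuous_FTC1 R (h \o clamp) (BLeft (-1)) t 2.
- by rewrite (le_lt_trans t1)// ltr1n.
- apply: continuous_compact_integrable; first exact: segment_compact.
  exact: continuous_subspaceT.
- by rewrite lte_fin (lt_le_trans _ t0)// oppr_lt0.
- exact: ch.
split => //; rewrite -derive1E D2 /= /clamp.
by congr (h _); rewrite (max_idPr _)// (min_idPr _).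
Qed.

(** The mean value theorem bounds real and imaginary parts separately, hence the factor 2. It is not
    sharp, but the estimates below only need some constant. *)
Lemma is_int01_bound h v (M : R) : is_int01 h v ->
  (forall t, 0 <= t <= 1 -> `|h t| <= toC M) -> `|v| <= toC (2 * M).
Proof.
move=> [g1 [g2 [P1 P2 ->]]] hM.
have B1 : `|g1 1 - g1 0| <= M.
  apply: primitive01_bound P1 _ => t /hM.
  by rewrite -ler_toC; apply: le_trans; exact: ler_norm_ReC.
have B2 : `|g2 1 - g2 0| <= M.
  apply: primitive01_bound P2 _ => t /hM.
  by rewrite -ler_toC; apply: le_trans; exact: ler_norm_ImC.
rewrite (le_trans (ler_normD _ _))// normrM norm_iC mul1r !norm_toC -toCD ler_toC.
by rewrite mulrDl mul1r lerD.
Qed.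

Lemma is_int01D h k v w : is_int01 h v -> is_int01 k w ->
  is_int01 (fun t => h t + k t) (v + w).
Proof.
move=> [g1 [g2 [P1 P2 ->]]] [k1 [k2 [Q1 Q2 ->]]].
exists (fun t => g1 t + k1 t), (fun t => g2 t + k2 t); split.
- move=> t t01; rewrite ReCD.
  exact: is_deriveD (P1 t t01) (Q1 t t01).
- move=> t t01; rewrite ImCD.
  exact: is_deriveD (P2 t t01) (Q2 t t01).
by rewrite !toCB !toCD; ring.
Qed.

Lemma is_int01Z h v (c : C) : is_int01 h v -> is_int01 (fun t => c * h t) (c * v).
Proof.
move=> [g1 [g2 [P1 P2 ->]]].
exists (fun t => ReC c * g1 t - ImC c * g2 t), (fun t => ReC c * g2 t + ImC c * g1 t); split.
- move=> t t01; rewrite ReCM.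
  exact: is_deriveB (is_deriveZ (ReC c) (P1 t t01)) (is_deriveZ (ImC c) (P2 t t01)).
- move=> t t01; rewrite ImCM.
  exact: is_deriveD (is_deriveZ (ReC c) (P2 t t01)) (is_deriveZ (ImC c) (P1 t t01)).
rewrite {1}(CE c).
have i2 : iC R * iC R = -1 by exact: sqr_i.
rewrite !toCB !toCD !toCM.
ring: i2.
Qed.

Lemma is_int01_ext h k v : (forall t, 0 <= t <= 1 -> h t = k t) ->
  is_int01 h v -> is_int01 k v.
Proof.
move=> hk [g1 [g2 [P1 P2 ->]]]; exists g1, g2.
by split=> // t t01; rewrite -hk//; [exact: P1|exact: P2].
Qed.

(** The difference [v - w] is an integral of the zero function, to which the bound with [M = 0]
    applies. *)
Lemma is_int01_uniq h v w : is_int01 h v -> is_int01 h w -> v = w.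
Proof.
move=> Hv /(is_int01Z (-1)) /(is_int01D Hv) /is_int01_bound - /(_ 0).
rewrite mulr0 toC0 mulN1r => H; apply/eqP; rewrite -subr_eq0 -normr_le0.
by apply: H => t _; rewrite mulN1r subrr normr0.
Qed.

Lemma is_int01_exists h : (forall t : R, 0 <= t <= 1 -> {for t, continuous h}) ->
  exists v, is_int01 h v.
Proof.
move=> hc.
have [t /hc ?|g1 P1] := @primitive01_exists (fun t => ReC (h t)).
  by apply: continuous_comp => //; exact: ReC_continuous.
have [t /hc ?|g2 P2] := @primitive01_exists (fun t => ImC (h t)).
  by apply: continuous_comp => //; exact: ImC_continuous.
by eexists; exists g1, g2; split.
Qed.

Lemma primitive01_affine h g (p q : R) :
  (forall t, 0 <= t <= 1 -> 0 <= p + q * t <= 1) -> primitive01 h g ->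
  primitive01 (fun t => q * h (p + q * t)) (fun t => g (p + q * t)).
Proof.
move=> pq hg t t01; have /is_derive_epsP H := hg _ (pq _ t01).
apply/is_derive_epsP => e e0.
(* Separate case, since otherwise the estimate for [g] is used with [e / |q|]. *)
have [->|q0] := eqVneq q 0.
  near=> s; rewrite !mul0r subrr sub0r -[s *: 0]/(s * 0) mulr0 oppr0 normr0.
  by rewrite mulr_ge0// ltW.
have e0' : 0 < e / `|q| by rewrite divr_gt0 ?normr_gt0.
have H0 : \forall s \near (0 : R), `|g (p + q * t + (q * s) *: 1) - g (p + q * t)
    - (q * s) *: h (p + q * t)| <= e / `|q| * `|q * s|.
  have oint_inv : (q * s) @[s --> (0 : R)] --> (0 : R).
    by rewrite -[X in _ --> X](mulr0 q); apply: cvgMl_tmp; exact: cvg_id.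
  exact: oint_inv (H _ e0').
apply: filterS H0 => s; rewrite normrM mulrA divfK ?normr_eq0//.
rewrite -[(q * s) *: 1]/(q * s * 1) -[s *: 1]/(s * 1) !mulr1.
rewrite -[(q * s) *: _]/(q * s * _) -[s *: _]/(s * _).
by rewrite mulrDr addrA [q * s]mulrC -mulrA.
Unshelve. all: by end_near.
Qed.

Lemma is_int01_rev h v : is_int01 h v -> is_int01 (fun t => h (1 - t)) v.
Proof.
move=> [g1 [g2 [P1 P2 ->]]].
have pq (t : R) : 0 <= t <= 1 -> 0 <= 1 + -1 * t <= 1 by lra.
have Q1 := primitive01_affine pq P1; have Q2 := primitive01_affine pq P2.
exists (fun t => - g1 (1 + -1 * t)), (fun t => - g2 (1 + -1 * t)); split.
- move=> t /Q1 ?; apply: (is_derive_eq (f := - (fun t => g1 (1 + -1 * t)))).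
  by rewrite !mulN1r opprK.
- move=> t /Q2 ?; apply: (is_derive_eq (f := - (fun t => g2 (1 + -1 * t)))).
  by rewrite !mulN1r opprK.
rewrite !mulN1r oppr0 subrr addr0.
by congr (toC _ + _ * toC _); rewrite opprK addrC.
Qed.

(** Stretching each half to the full interval doubles its integral. *)
Lemma is_int01_split h v v1 v2 : is_int01 h v ->
  is_int01 (fun t => h (t / 2)) v1 -> is_int01 (fun t => h ((1 + t) / 2)) v2 ->
  v1 + v2 = 2 * v.
Proof.
move=> [g1 [g2 [P1 P2 ->]]] H1 H2.
have pq (t : R) : 0 <= t <= 1 -> 0 <= 0 + 2^-1 * t <= 1 by lra.
have pq' (t : R) : 0 <= t <= 1 -> 0 <= 2^-1 + 2^-1 * t <= 1 by lra.
have Q1 := primitive01_affine pq P1; have Q2 := primitive01_affine pq P2.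
have Q1' := primitive01_affine pq' P1; have Q2' := primitive01_affine pq' P2.
have v1E : 2^-1 * v1 = toC (g1 2^-1 - g1 0) + iC R * toC (g2 2^-1 - g2 0).
  apply: is_int01_uniq (is_int01Z 2^-1 H1) _; rewrite -toC_nat -toCV.
  exists (fun t => g1 (0 + 2^-1 * t)), (fun t => g2 (0 + 2^-1 * t)); split.
  - move=> t /Q1; rewrite ReC_toCM.
    by have -> : t / 2 = 0 + 2^-1 * t by rewrite add0r mulrC.
  - move=> t /Q2; rewrite ImC_toCM.
    by have -> : t / 2 = 0 + 2^-1 * t by rewrite add0r mulrC.
  by rewrite !add0r mulr0 mulr1.
have v2E : 2^-1 * v2 = toC (g1 1 - g1 2^-1) + iC R * toC (g2 1 - g2 2^-1).
  apply: is_int01_uniq (is_int01Z 2^-1 H2) _; rewrite -toC_nat -toCV.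
  exists (fun t => g1 (2^-1 + 2^-1 * t)), (fun t => g2 (2^-1 + 2^-1 * t)); split.
  - move=> t /Q1'; rewrite ReC_toCM.
    by have -> : (1 + t) / 2 = 2^-1 + 2^-1 * t by rewrite mulrDl mul1r [t * _]mulrC.
  - move=> t /Q2'; rewrite ImC_toCM.
    by have -> : (1 + t) / 2 = 2^-1 + 2^-1 * t by rewrite mulrDl mul1r [t * _]mulrC.
  have h2 : 2^-1 + 2^-1 = 1 :> R by lra.
  by rewrite mulr0 mulr1 addr0 h2.
have -> : v1 + v2 = 2 * (2^-1 * v1 + 2^-1 * v2) by field.
by rewrite v1E v2E !toCB; ring.
Qed.

End UnitIntervalIntegral.

(** * Integrals along segments in the complex plane *)

Section SegmentIntegral.
Variable R : realType.
Local Notation C := (Cplx R).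
Implicit Types (a b c z w : C) (f g : C -> C).

Definition segpt a b (t : R) : C := a + toC t * (b - a).

Definition seg a b : set C := [set z | exists2 t : R, 0 <= t <= 1 & z = segpt a b t].

Definition cont_on (A : set C) f := forall z, A z -> {for z, continuous f}.

(* [0] when the integral does not exist *)
Definition seg_int a b f : C := (b - a) * xget 0 (is_int01 (fun t => f (segpt a b t))).

Lemma segptE a b t : segpt a b t = toC (1 - t) * a + toC t * b.
Proof. by rewrite /segpt toCB toC1; ring. Qed.

Lemma seg_left a b : seg a b a.
Proof. by exists 0; rewrite ?lexx ?ler01// /segpt toC0 mul0r addr0. Qed.

Lemma segC a b : seg b a = seg a b.
Proof.
have sub x y : seg x y `<=` seg y x.
  move=> z [t t01 ->]; exists (1 - t); first by lra.
  by rewrite !segptE subKr addrC.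
by apply/seteqP; split; exact: sub.
Qed.

Lemma norm_seg a b w z (r : C) : seg a b z -> `|a - w| <= r -> `|b - w| <= r -> `|z - w| <= r.
Proof.
move=> [t /andP[t0 t1] ->] ar br.
have -> : segpt a b t - w = toC (1 - t) * (a - w) + toC t * (b - w).
  by rewrite segptE toCB toC1; ring.
have -> : r = toC (1 - t) * r + toC t * r by rewrite toCB toC1; ring.
rewrite (le_trans (ler_normD _ _))// !normrM !norm_toC (ger0_norm t0).
rewrite (@ger0_norm _ (1 - t)) ?subr_ge0//.
by apply: lerD; apply: ler_wpM2l => //; rewrite toC_ge0 ?subr_ge0.
Qed.

Lemma segpt_continuous a b : continuous (segpt a b).
Proof.
move=> t; apply: cvgD; first exact: cvg_cst.
by apply: cvgM; [exact: toC_continuous|exact: cvg_cst].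
Qed.

Lemma seg_intP a b f : cont_on (seg a b) f ->
  exists2 v, is_int01 (fun t => f (segpt a b t)) v & seg_int a b f = (b - a) * v.
Proof.
move=> fc; have [t t01|v Hv] := @is_int01_exists R (fun t => f (segpt a b t)).
  by apply: continuous_comp; [exact: segpt_continuous|apply: fc; exists t].
by eexists; [apply: (xgetI 0 Hv)|].
Qed.

Lemma seg_intE a b f v : is_int01 (fun t => f (segpt a b t)) v -> seg_int a b f = (b - a) * v.
Proof.
move=> Hv; congr (_ * _); apply: is_int01_uniq (Hv).
exact: (xgetI 0 Hv).
Qed.

Lemma seg_int_lin a b f g c : cont_on (seg a b) f -> cont_on (seg a b) g ->
  seg_int a b (fun z => c * f z + g z) = c * seg_int a b f + seg_int a b g.
Proof.
move=> /seg_intP[v Hv ->] /seg_intP[w Hw ->].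
by rewrite (seg_intE (is_int01D (is_int01Z c Hv) Hw)); ring.
Qed.

Lemma seg_int_ext a b f g : (forall z, seg a b z -> f z = g z) ->
  seg_int a b f = seg_int a b g.
Proof.
move=> fg; congr (_ * xget _ _); apply/seteqP; split=> v; apply: is_int01_ext => t t01.
  by apply: fg; exists t.
by apply/esym/fg; exists t.
Qed.

Lemma ge0_toC z : 0 <= z -> z = toC (ReC z).
Proof. by case: z => x y; rewrite lecE /= => /andP[/eqP -> _]. Qed.

Lemma seg_int_bound a b f (M : C) : cont_on (seg a b) f ->
  (forall z, seg a b z -> `|f z| <= M) -> `|seg_int a b f| <= 2 * M * `|b - a|.
Proof.
move=> /seg_intP[v Hv ->] fM; rewrite normrM mulrC ler_wpM2r//.
(* In the order of [C] a nonnegative element is real, so [M] may serve as a real bound. *)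
have /ge0_toC ME : 0 <= M by rewrite (le_trans _ (fM _ (seg_left a b))).
rewrite ME -toC_nat -toCM; apply: is_int01_bound Hv _ => t t01.
by rewrite -ME; apply: fM; exists t.
Qed.

Lemma seg_int_rev a b f : cont_on (seg a b) f -> seg_int b a f = - seg_int a b f.
Proof.
move=> /seg_intP[v Hv ->]; rewrite -mulNr opprB; apply: seg_intE.
apply: is_int01_ext (is_int01_rev Hv) => t t01.
by rewrite !segptE subKr addrC.
Qed.

Lemma seg_int_split a b f : cont_on (seg a b) f ->
  seg_int a b f = seg_int a ((a + b) / 2) f + seg_int ((a + b) / 2) b f.
Proof.
move=> fc; have [v Hv ->] := seg_intP fc.
have E1 t : segpt a ((a + b) / 2) t = segpt a b (t / 2).
  by rewrite /segpt toCM toCV toC_nat; field.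
have E2 t : segpt ((a + b) / 2) b t = segpt a b ((1 + t) / 2).
  by rewrite /segpt toCM toCD toC1 toCV toC_nat; field.
have [z [t t01 ->]|v1 Hv1 ->] := @seg_intP a ((a + b) / 2) f.
  by apply: fc; rewrite E1; exists (t / 2) => //; lra.
have [z [t t01 ->]|v2 Hv2 ->] := @seg_intP ((a + b) / 2) b f.
  by apply: fc; rewrite E2; exists ((1 + t) / 2) => //; lra.
have /(_ v1 v2) H := is_int01_split Hv.
have {}H : v1 + v2 = 2 * v.
  by apply: H; [apply: is_int01_ext Hv1|apply: is_int01_ext Hv2] => t _; rewrite ?E1 ?E2.
have -> : (b - a) * v = (b - a) / 2 * (2 * v) by field.
by rewrite -H; field.
Qed.

(** Keeping the factor [b - a] inside the integrand avoids a division and covers [a = b]. *)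
Lemma is_int01_ftc a b f F : (forall z, seg a b z -> is_derive z 1 F (f z)) ->
  is_int01 (fun t => f (segpt a b t) * (b - a)) (F b - F a).
Proof.
move=> Ff.
have D (t : R) : 0 <= t <= 1 ->
    is_derive t 1 (fun s : R => ReC (F (segpt a b s))) (ReC (f (segpt a b t) * (b - a))) /\
    is_derive t 1 (fun s : R => ImC (F (segpt a b s))) (ImC (f (segpt a b t) * (b - a))).
  move=> t01; apply: (@is_derive_line R C F a (b - a) t).
  by apply: is_derive_dir; apply: Ff; exists t.
exists (fun s : R => ReC (F (segpt a b s))), (fun s : R => ImC (F (segpt a b s))).
split=> [t t01|t t01|]; [exact: (D t t01).1|exact: (D t t01).2|].
rewrite /segpt !toC1 !toC0 !mul0r !mul1r addr0 [a + _]addrC subrK.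
by rewrite -ReCB -ImCB -CE.
Qed.

Lemma seg_int_ftc a b f F : (forall z, seg a b z -> is_derive z 1 F (f z)) ->
  seg_int a b f = F b - F a.
Proof.
move=> /is_int01_ftc H.
have [->|ab] := eqVneq a b; first by rewrite /seg_int !subrr mul0r.
have ba : b - a != 0 by rewrite subr_eq0 eq_sym.
rewrite (@seg_intE a b f ((b - a)^-1 * (F b - F a))); first by rewrite mulrA divff// mul1r.
by apply: is_int01_ext (is_int01Z (b - a)^-1 H) => t t01; field.
Qed.

(** A derivative is integrable in the sense of [is_int01] by definition, so the bound on integrals
    becomes a mean value inequality. *)
Lemma mean_value_bound a b f F (M : C) :
  (forall z, seg a b z -> is_derive z 1 F (f z)) ->
  (forall z, seg a b z -> `|f z| <= M) -> `|F b - F a| <= 2 * M * `|b - a|.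
Proof.
move=> /is_int01_ftc H fM.
have ME : 0 <= M * `|b - a| by rewrite mulr_ge0// (le_trans _ (fM _ (seg_left a b))).
rewrite -mulrA (ge0_toC ME) -toC_nat -toCM.
apply: is_int01_bound H _ => t t01; rewrite -ge0_toC// normrM ler_wpM2r//.
by apply: fM; exists t.
Qed.

End SegmentIntegral.

(** * Goursat's theorem *)

Section Goursat.
Variable R : realType.
Local Notation C := (Cplx R).
Implicit Types (a b c z w : C) (f g : C -> C).

Definition tri_int f (t : C * C * C) : C :=
  seg_int t.1.1 t.1.2 f + seg_int t.1.2 t.2 f + seg_int t.2 t.1.1 f.

(** Measures the size of a triangle: it halves exactly under bisection and bounds both the integral
    and the distance of boundary points from the first vertex. *)
Definition perimeter (t : C * C * C) : C :=
  `|t.1.2 - t.1.1| + `|t.2 - t.1.2| + `|t.1.1 - t.2|.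

Definition tri_in (K : set C) (t : C * C * C) := [/\ K t.1.1, K t.1.2 & K t.2].

Definition convex_set (K : set C) :=
  forall a b, K a -> K b -> seg a b `<=` K.

Lemma derivable_continuous f z : derivable f z 1 -> {for z, continuous f}.
Proof. by move=> /derivable1_diffP /differentiable_continuous. Qed.

Lemma midpoint_seg a b : seg a b ((a + b) / 2).
Proof.
exists 2^-1; first by lra.
by rewrite /segpt toCV toC_nat; field.
Qed.

(** The four midpoint triangles carry the same orientation, so each inner edge is traversed once in
    each direction and cancels. *)
Lemma tri_int_split (K : set C) f t : convex_set K -> cont_on K f -> tri_in K t ->
  let: (a, b, c) := t in
  tri_int f t = tri_int f (a, (a + b) / 2, (c + a) / 2)
           + tri_int f ((a + b) / 2, b, (b + c) / 2)
           + tri_int f ((c + a) / 2, (b + c) / 2, c)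
           + tri_int f ((a + b) / 2, (b + c) / 2, (c + a) / 2).
Proof.
case: t => [[a b] c] cK fK [/= Ka Kb Kc].
have fs x y : K x -> K y -> cont_on (seg x y) f by move=> Kx Ky z /(cK _ _ Kx Ky)/fK.
have Km x y : K x -> K y -> K ((x + y) / 2).
  by move=> Kx Ky; apply: (cK _ _ Kx Ky); exact: midpoint_seg.
rewrite /tri_int /=.
rewrite (seg_int_split (fs _ _ Ka Kb)) (seg_int_split (fs _ _ Kb Kc)).
rewrite (seg_int_split (fs _ _ Kc Ka)).
rewrite (seg_int_rev (fs _ _ (Km _ _ Kc Ka) (Km _ _ Ka Kb))).
rewrite (seg_int_rev (fs _ _ (Km _ _ Ka Kb) (Km _ _ Kb Kc))).
rewrite (seg_int_rev (fs _ _ (Km _ _ Kb Kc) (Km _ _ Kc Ka))).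
by ring.
Qed.

Lemma affine_continuous (p q : C) : continuous (fun z => p + q * z).
Proof.
move=> z; apply: (@continuousD _ _ _ (cst p) (fun z => q * z)); first exact: cst_continuous.
by apply: (@continuousM _ _ (cst q) id); [exact: cst_continuous|exact: cvg_id].
Qed.

Lemma tri_int_affine (p q : C) t : tri_int (fun z => p + q * z) t = 0.
Proof.
have D z : is_derive z 1 (fun z => p * z + q / 2 * (z * z)) (p + q * z).
  have := is_deriveD (is_deriveZ p (is_derive_id z 1))
    (is_deriveZ (q / 2) (is_deriveM (is_derive_id z 1) (is_derive_id z 1))).
  move/is_derive_eq; apply.
  by rewrite -![_ *: _]/(_ * _) /=; field.
rewrite /tri_int !(@seg_int_ftc _ _ _ _ (fun z => p * z + q / 2 * (z * z)))//.
by ring.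
Qed.

Lemma perimeter_ge0 t : 0 <= perimeter t.
Proof. by rewrite !addr_ge0. Qed.

Lemma tri_int_bound (K : set C) f t (M : C) : convex_set K -> cont_on K f -> tri_in K t ->
  (forall z, seg t.1.1 t.1.2 z \/ seg t.1.2 t.2 z \/ seg t.2 t.1.1 z -> `|f z| <= M) ->
  `|tri_int f t| <= 2 * M * perimeter t.
Proof.
move=> cK fK [Ka Kb Kc] fM.
have fs x y : K x -> K y -> cont_on (seg x y) f by move=> Kx Ky z /(cK _ _ Kx Ky)/fK.
rewrite /tri_int /perimeter !mulrDr.
rewrite (le_trans (ler_normD _ _))// lerD//; last first.
  by apply: seg_int_bound; [exact: fs|move=> z ?; apply: fM; right; right].
rewrite (le_trans (ler_normD _ _))// lerD//.
  by apply: seg_int_bound; [exact: fs|move=> z ?; apply: fM; left].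
by apply: seg_int_bound; [exact: fs|move=> z ?; apply: fM; right; left].
Qed.

Lemma norm_tri t z : seg t.1.1 t.1.2 z \/ seg t.1.2 t.2 z \/ seg t.2 t.1.1 z ->
  `|z - t.1.1| <= perimeter t.
Proof.
case: t => [[a b] c] /=; rewrite /perimeter /=.
have A : `|a - a| <= `|b - a| + `|c - b| + `|a - c| by rewrite subrr normr0 !addr_ge0.
have B : `|b - a| <= `|b - a| + `|c - b| + `|a - c| by rewrite -addrA lerDl addr_ge0.
have D : `|c - a| <= `|b - a| + `|c - b| + `|a - c|.
  by rewrite distrC lerDr addr_ge0.
by case=> [|[|]] /norm_seg; apply.
Qed.

(** If all four quarters satisfied the estimate, each would contribute at most
    [e * perimeter t ^+ 2 / 4], and the sum would give the estimate for [t]. The square of the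
    perimeter keeps [e] unchanged from one generation to the next. *)
Lemma tri_int_bisect (K : set C) f (e : C) t : convex_set K -> cont_on K f -> 0 <= e ->
  tri_in K t -> ~ (`|tri_int f t| <= e * perimeter t ^+ 2) ->
  exists t', [/\ tri_in K t', ~ (`|tri_int f t'| <= e * perimeter t' ^+ 2),
    perimeter t' = perimeter t / 2 & `|t'.1.1 - t.1.1| <= perimeter t].
Proof.
move=> cK fK e0 Kt bad; apply: contrapT => H; apply: bad.
have {}H t' : tri_in K t' -> perimeter t' = perimeter t / 2 ->
    `|t'.1.1 - t.1.1| <= perimeter t -> `|tri_int f t'| <= e * perimeter t ^+ 2 / 4.
  move=> Kt' pt' at'; apply: contrapT => bad; apply: H; exists t'; split=> //.
  rewrite pt'.
  by have -> : e * (perimeter t / 2) ^+ 2 = e * perimeter t ^+ 2 / 4 by field.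
have Km x y : K x -> K y -> K ((x + y) / 2).
  by move=> Kx Ky; apply: (cK _ _ Kx Ky); exact: midpoint_seg.
have := tri_int_split cK fK Kt.
case: t Kt H => [[a b] c] [/= Ka Kb Kc] H ->.
have half x : `|x / 2| = `|x| / 2 by rewrite normrM [`|2^-1|]ger0_norm ?invr_ge0.
set p := perimeter _ in H *.
have inseg z : seg a b z \/ seg b c z \/ seg c a z -> `|z - a| <= p.
  exact: (@norm_tri (a, b, c)).
have Kab := Km _ _ Ka Kb; have Kbc := Km _ _ Kb Kc; have Kca := Km _ _ Kc Ka.
have p1 : perimeter (a, (a + b) / 2, (c + a) / 2) = p / 2.
  rewrite /p /perimeter /= !mulrDl -!half.
  by congr (_ + _ + _); congr (Num.norm _); field.
have p2 : perimeter ((a + b) / 2, b, (b + c) / 2) = p / 2.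
  rewrite /p /perimeter /= !mulrDl -!half.
  by congr (_ + _ + _); congr (Num.norm _); field.
have p3 : perimeter ((c + a) / 2, (b + c) / 2, c) = p / 2.
  rewrite /p /perimeter /= !mulrDl -!half.
  by congr (_ + _ + _); congr (Num.norm _); field.
have p4 : perimeter ((a + b) / 2, (b + c) / 2, (c + a) / 2) = p / 2.
  rewrite /p /perimeter /=.
  have -> : (b + c) / 2 - (a + b) / 2 = - ((a - c) / 2) by field.
  have -> : (c + a) / 2 - (b + c) / 2 = - ((b - a) / 2) by field.
  have -> : (a + b) / 2 - (c + a) / 2 = - ((c - b) / 2) by field.
  by rewrite !normrN !half; field.
have := H (a, (a + b) / 2, (c + a) / 2) => /(_ _ p1) H1.
have := H ((a + b) / 2, b, (b + c) / 2) => /(_ _ p2) H2.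
have := H ((c + a) / 2, (b + c) / 2, c) => /(_ _ p3) H3.
have := H ((a + b) / 2, (b + c) / 2, (c + a) / 2) => /(_ _ p4) H4.
have -> : e * p ^+ 2 = e * p ^+ 2 / 4 + e * p ^+ 2 / 4 + e * p ^+ 2 / 4 + e * p ^+ 2 / 4.
  by field.
rewrite (le_trans (ler_normD _ _))// lerD//; last first.
  by apply: H4 => //=; apply: inseg; left; exact: midpoint_seg.
rewrite (le_trans (ler_normD _ _))// lerD//; last first.
  by apply: H3 => //=; apply: inseg; right; right; exact: midpoint_seg.
rewrite (le_trans (ler_normD _ _))// lerD//.
  by apply: H1 => //=; rewrite subrr normr0; exact: perimeter_ge0.
by apply: H2 => //=; apply: inseg; left; exact: midpoint_seg.
Qed.

Lemma exists_pow2_gt (x : C) : 0 <= x -> forall e : C, 0 < e -> exists n, x / 2 ^+ n < e.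
Proof.
move=> x0 e e0.
have xe : 0 <= x / e by rewrite divr_ge0// ltW.
have /archi_boundP H : 0 <= ReC (x / e) by rewrite -toC_ge0 -ge0_toC.
exists (Num.bound (ReC (x / e))).
rewrite ltr_pdivrMr ?exprn_gt0// mulrC -ltr_pdivrMr//.
rewrite (ge0_toC xe) (lt_trans (_ : _ < (Num.bound (ReC (x / e)))%:R))//.
  by rewrite -[X in _ < X]toC_nat ltr_toC.
by rewrite -natrX ltr_nat ltn_expl.
Qed.

(** The first vertices of a chain of bad triangles have a cluster point [p] in [K]. Near [p], [f] is
    affine up to a small error, and affine functions integrate to zero, so a late triangle cannot be
    bad. *)
Lemma goursat_bound (K : set C) f (e : C) t : compact K -> convex_set K ->
  (forall z, K z -> derivable f z 1) -> 0 < e -> tri_in K t ->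
  `|tri_int f t| <= e * perimeter t ^+ 2.
Proof.
move=> cpK cK fK e0 Kt; apply: contrapT => bad0.
have fc : cont_on K f by move=> z /fK/derivable_continuous.
pose bad u := tri_in K u /\ ~ (`|tri_int f u| <= e * perimeter u ^+ 2).
pose R' u u' := [/\ bad u', perimeter u' = perimeter u / 2 &
  `|u'.1.1 - u.1.1| <= perimeter u].
have step u : exists u', bad u -> R' u u'.
  have [[Ku bu]|nb] := pselect (bad u); last by exists u.
  by have [u' [? ? ? ?]] := tri_int_bisect cK fc (ltW e0) Ku bu; exists u'.
have [nxt Hnxt] := choice step.
pose s n := iter n nxt t.
have sb n : bad (s n) by elim: n => [//|n IH]; have [] := Hnxt _ IH.
have sp n : perimeter (s n) = perimeter t / 2 ^+ n.
  elim: n => [|n IH]; first by rewrite expr0 divr1.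
  have [_ /= -> _] := Hnxt _ (sb n); rewrite -/(s n) IH exprSr.
  by field; rewrite expf_neq0// pnatr_eq0.
(* Each step moves the vertex by at most the current perimeter, and perimeters halve: a geometric
   sum. *)
have sd n k : `|(s (n + k)%N).1.1 - (s n).1.1| <=
    2 * perimeter (s n) - 2 * perimeter (s (n + k)%N).
  elim: k => [|k IH]; first by rewrite addn0 !subrr normr0.
  rewrite addnS; have [_ pk dk] := Hnxt _ (sb (n + k)%N).
  rewrite -[s (n + k).+1]/(nxt (s (n + k)%N)).
  rewrite -(subrK (s (n + k)%N).1.1 (nxt _).1.1) -addrA.
  rewrite (le_trans (ler_normD _ _))// (le_trans (lerD dk IH))// pk.
  by rewrite le_eqVlt; apply/orP; left; apply/eqP; field.
(* A triangle of perimeter 0 has integral 0 and is not bad. Positivity lets the perimeter serve as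
   the radius of a neighbourhood of [p]. *)
have pgt0 n : 0 < perimeter (s n).
  rewrite lt_neqAle perimeter_ge0 andbT; apply/negP => /eqP p0.
  have [[Ka Kb Kc] []] := sb n.
  suff -> : tri_int f (s n) = 0.
    by rewrite normr0; apply: mulr_ge0; [exact: ltW|exact/exprn_ge0/perimeter_ge0].
  have : `|tri_int f (s n)| <= 0.
    have nz z : seg (s n).1.1 (s n).1.2 z \/ seg (s n).1.2 (s n).2 z \/
        seg (s n).2 (s n).1.1 z -> `|f z| <= `|f (s n).1.1|.
      by move=> /norm_tri; rewrite -p0 normr_le0 subr_eq0 => /eqP ->.
    by have [+ _] := sb n => /(tri_int_bound cK fc)/(_ nz); rewrite -p0 mulr0.
  by rewrite normr_le0 => /eqP.
have sK : \forall n \near \oo, K (s n).1.1 by apply: nearW => n; have [[]] := sb n.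
have [p [Kp clp]] := cpK ((fun n => (s n).1.1) @ \oo) _ sK.
(* Two perimeters for the drift of the vertices, one for a late vertex near [p]. *)
have pd n : `|(s n).1.1 - p| <= 3 * perimeter (s n).
  have [||q [[k nk <-] /= kp]] := clp [set (s k).1.1 | k in [set k | (n <= k)%N]]
      (fun q => `|p - q| < perimeter (s n)).
  - have : \forall k \near \oo, (n <= k)%N by exact: nbhs_infty_ge.
    by apply: filterS => k nk; exists k.
  - exact: near_distC.
  have := sd n (k - n)%N; rewrite subnKC// => H.
  rewrite -(subrK (s k).1.1 (s n).1.1) -addrA (le_trans (ler_normD _ _))//.
  have -> : 3 * perimeter (s n) = 2 * perimeter (s n) + perimeter (s n) by ring.
  rewrite lerD//; last by rewrite distrC ltW.
  by rewrite distrC (le_trans H)// gerBl mulr_ge0// perimeter_ge0.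
have /derivableP/is_derive_epsP := fK _ Kp; set l := 'D_1 f p.
(* 8 is 2 times 4: [tri_int_bound] costs a factor 2, and boundary points of [s n] lie within 4
   perimeters of [p], namely 3 up to the first vertex and 1 from there. The latter 4 reappears in
   [d / 4]. *)
have e8 : 0 < e / 8 by rewrite divr_gt0.
move=> /(_ _ e8) /nbhs_normP [d /= d0 Hd].
have [|n] := exists_pow2_gt (perimeter_ge0 t) (_ : 0 < d / 4); first by rewrite divr_gt0.
rewrite -sp ltr_pdivlMr// => nd.
have [Kn []] := sb n.
(* The error of the first-order expansion of [f] at [p]; it has the same triangle integrals as
   [f]. *)
pose g z := -1 * (f p - l * p + l * z) + f z.
have gc : cont_on K g.
  move=> z Kz.
  apply: (@continuousD _ _ _ (fun z => -1 * (f p - l * p + l * z)) f); last exact: fc.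
  by apply: (@continuousM _ _ (cst (-1))); [exact: cst_continuous|exact: affine_continuous].
have -> : tri_int f (s n) = tri_int g (s n).
  have fs x y : K x -> K y -> cont_on (seg x y) f by move=> Kx Ky z /(cK _ _ Kx Ky)/fc.
  have ac x y : cont_on (seg x y) (fun z => f p - l * p + l * z).
    by move=> z _; exact: affine_continuous.
  have [Ka Kb Kc] := Kn.
  rewrite {2}/tri_int /g !seg_int_lin//; try exact: fs.
  rewrite -[LHS]addr0 -(mulr0 (-1)) -(tri_int_affine (f p - l * p) l (s n)) /tri_int.
  by ring.
have gb z : seg (s n).1.1 (s n).1.2 z \/ seg (s n).1.2 (s n).2 z \/
    seg (s n).2 (s n).1.1 z -> `|g z| <= e / 8 * (perimeter (s n) * 4).
  move=> /norm_tri zs.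
  have zp : `|z - p| <= perimeter (s n) * 4.
    rewrite -(subrK (s n).1.1 z) -addrA (le_trans (ler_normD _ _))//.
    have -> : perimeter (s n) * 4 = perimeter (s n) + 3 * perimeter (s n) by ring.
    by rewrite lerD.
  have /= := Hd (z - p); rewrite sub0r normrN (le_lt_trans zp nd) => /(_ isT).
  rewrite -[(z - p) *: 1]/((z - p) * 1) -[(z - p) *: l]/((z - p) * l) mulr1.
  rewrite [p + _]addrC subrK => H.
  have -> : g z = f z - f p - (z - p) * l by rewrite /g; ring.
  by rewrite (le_trans H)// ler_wpM2l// ltW.
rewrite (le_trans (tri_int_bound cK gc Kn gb))//.
by rewrite le_eqVlt; apply/orP; left; apply/eqP; field.
Unshelve. all: by end_near.
Qed.

Lemma goursat (K : set C) f a b c : compact K -> convex_set K ->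
  (forall z, K z -> derivable f z 1) -> K a -> K b -> K c ->
  seg_int a b f + seg_int b c f + seg_int c a f = 0.
Proof.
move=> cpK cK fK Ka Kb Kc; rewrite -[LHS]/(tri_int f (a, b, c)).
set t := (a, b, c); have Kt : tri_in K t by [].
have p1 : 0 < perimeter t ^+ 2 + 1 by rewrite ltr_wpDl ?exprn_ge0 ?perimeter_ge0.
apply/eqP; rewrite -normr_le0; apply/ler_addgt0Pl => e e0; rewrite addr0.
rewrite (le_trans (goursat_bound cpK cK fK (divr_gt0 e0 p1) Kt))//.
by rewrite mulrAC ler_pdivrMr// ler_wpM2l ?ltW// ltrDl.
Qed.

End Goursat.

(** * Primitives of holomorphic functions near a point *)

Section LocalPrimitive.
Variable R : realType.
Local Notation C := (Cplx R).
Implicit Types (a b c z w : C) (f g : C -> C).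

(** A square rather than a disc: it is the continuous image of a product of two real segments, hence
    compact, and it is convex, as Goursat's theorem requires. *)
Definition square w (s : R) : set C :=
  [set z | `|ReC (z - w)| <= s /\ `|ImC (z - w)| <= s].

Lemma square_convex w s : convex_set (square w s).
Proof.
move=> a b [a1 a2] [b1 b2] z [t /andP[t0 t1] ->]; rewrite /square /=.
have -> : segpt a b t - w = toC (1 - t) * (a - w) + toC t * (b - w).
  by rewrite segptE toCB toC1; ring.
have conv (x y : R) : `|x| <= s -> `|y| <= s -> `|(1 - t) * x + t * y| <= s.
  move=> xs ys; have -> : s = (1 - t) * s + t * s by ring.
  rewrite (le_trans (ler_normD _ _))// !normrM (ger0_norm t0) (@ger0_norm _ (1 - t)) ?subr_ge0//.
  by apply: lerD; apply: ler_wpM2l; rewrite ?subr_ge0.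
by split; rewrite ?ReCD ?ImCD ?ReC_toCM ?ImC_toCM; apply: conv.
Qed.

Lemma square_compact w s : compact (square w s).
Proof.
have -> : square w s =
    (fun x : R * R => w + (toC x.1 + iC R * toC x.2)) @` (`[- s, s] `*` `[- s, s]).
  apply/seteqP; split=> [z [z1 z2]|_ [[x y] [/= xs ys] <-]].
    exists (ReC (z - w), ImC (z - w)); last by rewrite /= -CE addrC subrK.
    by split; rewrite /= in_itv /= -ler_norml.
  rewrite /square /= addrC addKr ReCD ImCD ReCM ImCM !ReC_toC !ImC_toC.
  rewrite ReC_iC ImC_iC !(mul0r, mul1r, mulr0, subr0, addr0, add0r).
  by move: xs ys; rewrite !in_itv /= -!ler_norml.
apply: continuous_compact; last by apply: compact_setX; exact: segment_compact.
apply: continuous_subspaceT => x.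
apply: (@continuousD _ _ _ (cst w) (fun x : R * R => toC x.1 + iC R * toC x.2)).
  exact: cst_continuous.
apply: (@continuousD _ _ _ (fun x : R * R => toC x.1) (fun x : R * R => iC R * toC x.2)).
  by apply: continuous_comp; [exact: cvg_fst|exact: toC_continuous].
apply: (@continuousM _ _ (cst (iC R)) (fun x : R * R => toC x.2)).
  exact: cst_continuous.
by apply: continuous_comp; [exact: cvg_snd|exact: toC_continuous].
Qed.

Lemma ball_square w s z : `|z - w| <= toC s -> square w s z.
Proof.
move=> H; split; rewrite -ler_toC; apply: le_trans H.
  exact: ler_norm_ReC.
exact: ler_norm_ImC.
Qed.

Lemma square_ball w s z : square w s z -> `|z - w| <= toC (2 * s).
Proof.
move=> [H1 H2]; rewrite (le_trans (ler_norm_ReIm _))// ler_toC.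
by rewrite mulrDl mul1r lerD.
Qed.

(** The primitive integrates [f] from the centre [w] to [z]. Goursat's theorem on the triangle [w],
    [z], [z + h] turns its increment into the integral over the short segment from [z] to [z + h],
    where [f] is close to [f z]. *)
Lemma holo_primitive w (s : R) f : 0 < s ->
  (forall z, square w s z -> derivable f z 1) ->
  exists F, forall z, `|z - w| < toC s -> is_derive z 1 F (f z).
Proof.
move=> s0 fK; pose K := square w s.
have Kw : K w by apply: ball_square; rewrite subrr normr0 toC_ge0 ltW.
have fc : cont_on K f by move=> z /fK/derivable_continuous.
have cK : convex_set K := @square_convex w s.
have fs x y : K x -> K y -> cont_on (seg x y) f by move=> Kx Ky z /(cK _ _ Kx Ky)/fc.
exists (fun z => seg_int w z f) => z zw; apply/is_derive_epsP => e e0.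
have Kz : K z by apply: ball_square; exact: ltW.
have e2 : 0 < e / 2 by rewrite divr_gt0.
have /continuous_atP/(_ _ e2)/nbhs_normP[d /= d0 Hd] := fc z Kz.
have zs0 : 0 < toC s - `|z - w| by rewrite subr_gt0.
near=> h.
have hd : `|h| < d by rewrite -normrN -sub0r; near: h; exact: near_distC.
have hs : `|h| < toC s - `|z - w|.
  by rewrite -normrN -sub0r; near: h; exact: near_distC.
rewrite -[h *: 1]/(h * 1) -[h *: f z]/(h * f z) mulr1.
have Kzh : K (z + h).
  apply: ball_square; rewrite addrAC [_ + h]addrC (le_trans (ler_normD _ _))//.
  by rewrite -lerBrDr ltW.
have /= := goursat (@square_compact w s) cK fK Kw Kz Kzh.
rewrite (seg_int_rev (fs _ _ Kw Kzh)) => /eqP; rewrite subr_eq0 => /eqP <-.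
have -> : seg_int w z f + seg_int z (z + h) f - seg_int w z f - h * f z =
    seg_int z (z + h) (fun x => -1 * f z + f x).
  have Sc : seg_int z (z + h) (fun=> f z) = h * f z.
    have D (x : C) : is_derive x 1 (fun x => f z * x) (f z).
      have := is_deriveZ (f z) (is_derive_id x 1).
      by move/is_derive_eq; apply; rewrite -[_ *: _]/(_ * _) mulr1.
    rewrite (@seg_int_ftc _ _ _ _ (fun x => f z * x)).
    by ring.
  have cz : cont_on (seg z (z + h)) (fun=> f z) by move=> x _; exact: cst_continuous.
  by rewrite (seg_int_lin (-1) cz (fs _ _ Kz Kzh)) Sc; ring.
have -> : e * `|h| = 2 * (e / 2) * `|z + h - z|.
  by rewrite [z + h]addrC addrK; field.
apply: seg_int_bound => [x xs|x xs].
  apply: (@continuousD _ _ _ (cst (-1 * f z)) f); first exact: cst_continuous.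
  exact: fs xs.
rewrite mulN1r addrC -normrN opprB ltW//; apply: Hd => /=.
rewrite -normrN opprB (le_lt_trans _ hd)//; apply: norm_seg xs _ _.
  by rewrite subrr normr0.
by rewrite [z + h]addrC addrK.
Unshelve. all: by end_near.
Qed.

End LocalPrimitive.

(** * Cauchy's formula *)

Section Contour.
Variable R : realType.
Local Notation C := (Cplx R).
Local Notation I := (iC R).
Implicit Types (a b c z w : C) (f g : C -> C).

Lemma ReC1 : ReC (1 : C) = 1. Proof. by []. Qed.
Lemma ImC1 : ImC (1 : C) = 0. Proof. by []. Qed.

Lemma iC2 : I ^+ 2 = -1. Proof. exact: sqr_i. Qed.

Lemma iC4 : I ^+ 4 = 1.
Proof. by rewrite (exprM I 2 2) iC2 sqrrN expr1n. Qed.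

Lemma iC_neq0 : I != 0.
Proof. by rewrite -normr_eq0 norm_iC oner_eq0. Qed.

Definition diamond : set C := [set z | exists k : 'I_4, seg (I ^+ k) (I ^+ k.+1) z].

Definition oint g : C := \sum_(k < 4) seg_int (I ^+ k) (I ^+ k.+1) g.

Lemma cont_seg g (k : 'I_4) : cont_on diamond g -> cont_on (seg (I ^+ k) (I ^+ k.+1)) g.
Proof. by move=> gc z zs; apply: gc; exists k. Qed.

Lemma oint_lin f g c : cont_on diamond f -> cont_on diamond g ->
  oint (fun z => c * f z + g z) = c * oint f + oint g.
Proof.
move=> fc gc; rewrite mulr_sumr -big_split /=; apply: eq_bigr => k _.
by apply: seg_int_lin; exact: cont_seg.
Qed.

Lemma oint_ext f g : (forall z, diamond z -> f z = g z) -> oint f = oint g.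
Proof. by move=> fg; apply: eq_bigr => k _; apply: seg_int_ext => z zs; apply: fg; exists k. Qed.

Lemma diamond_norm z : diamond z -> `|z| <= 1.
Proof.
move=> [k zs]; rewrite -[z]subr0; apply: norm_seg zs _ _;
  by rewrite subr0 normrX norm_iC expr1n.
Qed.

(** Up to the rotation [I ^+ k] the point is [(1 - t) + i t], whose real and imaginary parts add up
    to 1. *)
Lemma diamond_neq0 z : diamond z -> z != 0.
Proof.
move=> [k [t t01 ->]]; rewrite segptE exprSr.
have -> : toC (1 - t) * I ^+ k + toC t * (I ^+ k * I) = I ^+ k * (toC (1 - t) + I * toC t).
  by ring.
rewrite mulf_neq0 ?expf_neq0 ?iC_neq0//; apply/eqP => H.
have : ReC (toC (1 - t) + I * toC t) = 0 := congr1 (@ReC R) H.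
have : ImC (toC (1 - t) + I * toC t) = 0 := congr1 (@ImC R) H.
rewrite ReCD ImCD ReCM ImCM !ReC_toC !ImC_toC ReC_iC ImC_iC.
by lra.
Qed.

(** 16 is the product of 4 edges, the factor 2 of [seg_int_bound], and 2 as a crude bound for the
    length of an edge. *)
Lemma oint_bound g (M : C) : cont_on diamond g -> (forall z, diamond z -> `|g z| <= M) ->
  `|oint g| <= 16 * M.
Proof.
move=> gc gM.
have M0 : 0 <= M.
  by apply: (le_trans (normr_ge0 (g 1))); apply: gM; exists ord0; exact: seg_left.
rewrite (le_trans (ler_norm_sum _ _ _))//.
have -> : 16 * M = \sum_(k < 4) (4 * M).
  by rewrite sumr_const card_ord -[RHS]mulr_natr; ring.
apply: ler_sum => k _; apply: (@le_trans _ _ (2 * M * `|I ^+ k.+1 - I ^+ k|)).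
  by apply: seg_int_bound; [exact: cont_seg|move=> z zs; apply: gM; exists k].
have -> : 4 * M = 2 * M * 2 by ring.
apply: ler_wpM2l; first by rewrite mulr_ge0.
rewrite (le_trans (ler_normB _ _))// !normrX norm_iC !expr1n.
by have -> : 1 + 1 = 2 :> C by ring.
Qed.

Lemma oint_ftc g F : (forall z, diamond z -> is_derive z 1 F (g z)) -> oint g = 0.
Proof.
move=> Fg; rewrite /oint (eq_bigr (fun k : 'I_4 => F (I ^+ k.+1) - F (I ^+ k))); last first.
  by move=> k _; apply: seg_int_ftc => z zs; apply: Fg; exists k.
rewrite -(big_mkord xpredT (fun k => F (I ^+ k.+1) - F (I ^+ k))) telescope_sumr//.
by rewrite iC4 expr0 subrr.
Qed.

Lemma is_derive_inv z : z != 0 -> is_derive z 1 (fun x : C => x^-1) (- z ^- 2).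
Proof.
move=> z0; have D := @derivableV C C id z 1 z0 (@derivable_id C C z 1).
split; first exact: D.
have := @deriveV C C id z 1 z0 (@derivable_id C C z 1).
by rewrite derive_id => ->; rewrite -[_ *: _]/(_ * _) mulr1.
Qed.

Lemma inv_continuous_on : cont_on diamond (fun z => z^-1).
Proof. by move=> z /diamond_neq0/is_derive_inv[+ _] => /derivable_continuous. Qed.

Lemma inv_sqr_continuous_on : cont_on diamond (fun z => z ^- 2).
Proof.
move=> z Gz; have H := inv_continuous_on Gz.
have -> : (fun z => z ^- 2) = (fun z : C => z^-1) \* (fun z : C => z^-1).
  by apply/funext => x /=; rewrite -expr2 exprVn.
exact: (continuousM H H).
Qed.

Lemma oint_inv_sqr : oint (fun z => z ^- 2) = 0.
Proof.
apply: (@oint_ftc _ (fun z => - z^-1)) => z /diamond_neq0/is_derive_inv H.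
by have := is_deriveN H => /is_derive_eq; apply; rewrite opprK.
Qed.

Definition oint_inv : C := oint (fun z => z^-1).

(** The form [dz / z] is invariant under rotation by i, so the four edges contribute equally, and
    the integrand on the edge from 1 to i is never real. *)
Lemma oint_inv_neq0 : oint_inv != 0.
Proof.
have c1 : cont_on (seg 1 I) (fun z => z^-1).
  by have := @cont_seg _ ord0 inv_continuous_on; rewrite expr0 expr1.
have -> : oint_inv = 4 * seg_int 1 I (fun z => z^-1).
  have {1}-> : (4 : C) = \sum_(k < 4) 1 by rewrite sumr_const card_ord.
  rewrite mulr_suml; apply: eq_bigr => k _; rewrite mul1r.
  have [v Hv ->] := seg_intP c1.
  have Ik : I ^+ k != 0 by rewrite expf_neq0 ?iC_neq0.
  rewrite (@seg_intE _ _ _ _ ((I ^+ k)^-1 * v)).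
    by rewrite exprSr; field.
  apply: is_int01_ext (is_int01Z _ Hv) => t t01.
  rewrite /segpt -invfM exprSr; congr (_^-1); ring.
rewrite mulf_neq0 ?pnatr_eq0//.
have [v Hv ->] := seg_intP c1.
have [g1 [g2 [P1 P2 E]]] := is_int01Z (I - 1) Hv.
apply/eqP => H.
have : ImC ((I - 1) * v) = 0 := congr1 (@ImC R) H.
rewrite E ImCD ImCM !ImC_toC !ReC_toC ImC_iC mulr0 !add0r mul1r => {H} g0.
(* If the integral vanished, [(I - 1) / z] would be a real number [x] at some point
   [z = (1 - t) + i t] of the edge. Comparing both parts of [x z = I - 1] gives [x (1 - t) = -1] and
   [x t = 1], so [x = 0], which is absurd. *)
have [|||t t01] := @MVT_segment R g2 (fun t => ImC ((I - 1) * (segpt 1 I t)^-1)) 0 1.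
- exact: ler01.
- by move=> t; rewrite in_itv /= => /andP[? ?]; apply: P2; rewrite !ltW.
- by apply: derivable_within_continuous => t; rewrite in_itv /= => /P2[].
rewrite g0 subr0 mulr1 => /esym h0.
have Gt : diamond (segpt 1 I t).
  by exists ord0; rewrite expr0 expr1; exists t => //; move: t01; rewrite in_itv.
have /diamond_neq0 st0 := Gt.
have hE : (I - 1) * (segpt 1 I t)^-1 * segpt 1 I t = I - 1 by rewrite mulfVK.
have Is : ImC (segpt 1 I t) = t.
  by rewrite segptE ImCD !ImC_toCM ImC_iC mulr1 ImC1 mulr0 add0r.
have Rs : ReC (segpt 1 I t) = 1 - t.
  by rewrite segptE ReCD !ReC_toCM ReC_iC mulr0 addr0 ReC1 mulr1.
have := congr1 (@ReC R) hE; have := congr1 (@ImC R) hE.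
rewrite ReCM ImCM h0 Is Rs !ReCB !ImCB ReC_iC ImC_iC ReC1 ImC1.
set x := ReC _ => e1 e2; have x0 : x = 0 by lra.
by move: e1; rewrite x0; lra.
Qed.

End Contour.

(** * Contour integrals depending on a parameter *)

Lemma continuous_pair (T U V : topologicalType) (f : T -> U) (g : T -> V) (x : T) :
  {for x, continuous f} -> {for x, continuous g} ->
  {for x, continuous (fun y => (f y, g y))}.
Proof. by move=> fc gc; exact: (cvg_pair fc gc). Qed.

Lemma continuous_at_comp (T U V : topologicalType) (f : T -> U) (g : U -> V) (x : T) :
  {for x, continuous f} -> {for f x, continuous g} ->
  {for x, continuous (fun y => g (f y))}.
Proof. by move=> fc gc A /gc /fc. Qed.

Section ContourParameter.
Variable R : realType.
Local Notation C := (Cplx R).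
Implicit Types (a b c z w : C) (f g : C -> C).

Lemma seg_compact a b : compact (seg a b).
Proof.
have -> : seg a b = segpt a b @` `[0, 1].
  apply/seteqP; split=> [z [t t01 ->]|_ [t + <-]].
    by exists t => //=; rewrite in_itv.
  by rewrite /= in_itv /= => t01; exists t.
apply: continuous_compact; last exact: segment_compact.
by apply: continuous_subspaceT => x; exact: segpt_continuous.
Qed.

(** The tube lemma on each compact edge. Near [(q0, z)] both [G q z'] and [G q0 z'] are within
    [e / 2] of [G q0 z]. *)
Lemma diamond_uniform (T : topologicalType) (G : T -> C -> C) (q0 : T) :
  (forall z, diamond z -> {for (q0, z), continuous (fun x : T * C => G x.1 x.2)}) ->
  forall e : C, 0 < e -> \forall q \near q0, forall z, diamond z -> `|G q0 z - G q z| < e.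
Proof.
move=> Gc e e0.
have H (k : 'I_4) : \forall q \near q0,
    seg (iC R ^+ k) (iC R ^+ k.+1) `<=` [set z | `|G q0 z - G q z| < e].
  have /compact_near_coveringP := @seg_compact (iC R ^+ k) (iC R ^+ k.+1).
  apply=> z zs.
  have /continuous_atP/(_ (e / 2)) : {for (q0, z), continuous (fun x : T * C => G x.1 x.2)}.
    by apply: Gc; exists k.
  rewrite divr_gt0// => /(_ isT) [[A B] /= [Aq Bz] AB].
  exists (B, A) => //= -[z' q] /= [Bz' Aq'].
  have H1 := AB (q, z') (conj Aq' Bz').
  have H2 := AB (q0, z') (conj (nbhs_singleton Aq) Bz').
  rewrite /= in H1 H2.
  rewrite (splitr e) -(subrK (G q0 z) (G q0 z')) -addrA.
  by rewrite (le_lt_trans (ler_normD _ _))// ltrD// distrC.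
have H' : \forall q \near q0, forall k : 'I_4,
    seg (iC R ^+ k) (iC R ^+ k.+1) `<=` [set z | `|G q0 z - G q z| < e].
  exact: filter_forall.
by apply: filterS H' => q Hq z [k zs]; exact: (Hq k).
Qed.

Lemma joint_slice (T : topologicalType) (G : T -> C -> C) (q : T) z :
  {for (q, z), continuous (fun x : T * C => G x.1 x.2)} -> {for z, continuous (G q)}.
Proof.
have pc : {for z, continuous (fun z => (q, z))}.
  by apply: continuous_pair; [exact: cst_continuous|exact: cvg_id].
by move=> Gc; exact: (continuous_at_comp pc Gc).
Qed.

Lemma joint_kernel (T V : topologicalType) (L : T * C -> V) (phi : V -> C) (k : C -> C)
    (x : T * C) :
  {for x, continuous L} -> {for L x, continuous phi} -> {for x.2, continuous k} ->
  {for x, continuous (fun x => phi (L x) * k x.2)}.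
Proof.
move=> Lc pc kc; apply: (@continuousM _ _ (phi \o L) (k \o snd)).
  exact: (continuous_at_comp Lc pc).
have sc : {for x, continuous (@snd T C)} by exact: cvg_snd.
exact: (continuous_at_comp sc kc).
Qed.

Lemma oint0 : oint (fun=> 0 : C) = 0.
Proof.
by apply: (@oint_ftc R _ (cst 0)) => z _; exact: is_derive_cst.
Qed.

Lemma ointZ c g : cont_on (@diamond R) g -> oint (fun z => c * g z) = c * oint g.
Proof.
move=> gc; have zc : cont_on (@diamond R) (fun=> 0) by move=> z _; exact: cst_continuous.
by rewrite -[RHS]addr0 -oint0 -oint_lin//; apply: oint_ext => z _; rewrite addr0.
Qed.

Lemma oint_continuous (T : topologicalType) (G : T -> C -> C) (q0 : T) :
  (\forall q \near q0, cont_on (@diamond R) (G q)) ->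
  (forall z, diamond z -> {for (q0, z), continuous (fun x : T * C => G x.1 x.2)}) ->
  {for q0, continuous (fun q => oint (G q))}.
Proof.
move=> Gq Gc; apply/continuous_atP => e e0.
(* One more than the constant 16 of [oint_bound], to end with a strict inequality. *)
have e17 : 0 < e / 17 by rewrite divr_gt0.
have := diamond_uniform Gc e17; apply: filterS2 Gq => q qc Hq.
have q0c : cont_on (@diamond R) (G q0) by move=> z Gz; apply: joint_slice; exact: Gc.
have -> : oint (G q0) - oint (G q) = oint (fun z => -1 * G q z + G q0 z).
  by rewrite oint_lin//; ring.
apply: (@le_lt_trans _ _ (16 * (e / 17))).
  apply: oint_bound => [z Gz|z Gz].
    apply: (@continuousD _ _ _ (fun z => -1 * G q z) (G q0)); last exact: q0c.
    by apply: (@continuousM _ _ (cst (-1)) (G q)); [exact: cst_continuous|exact: qc].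
  by rewrite mulN1r addrC ltW//; apply: Hq.
by rewrite mulrA mulrAC gtr_pMl// ltr_pdivrMr// mul1r ltr_nat.
Qed.

(** For fixed [x], the map sending [z] to [G z x - dG z0 x * z] has derivative [dG z x - dG z0 x],
    small uniformly in [x]. The mean value inequality bounds the error of the linear approximation
    of the integrand, and [oint_bound] that of the integral. *)
Lemma oint_derive (G dG : C -> C -> C) z0 :
  (\forall z \near z0, forall x, diamond x ->
    is_derive (z : C) 1 (fun z : C => G z x) (dG z x)) ->
  (\forall z \near z0, cont_on (@diamond R) (G z)) ->
  (forall z, diamond z -> {for (z0, z), continuous (fun x : C * C => dG x.1 x.2)}) ->
  is_derive z0 1 (fun z => oint (G z)) (oint (dG z0)).
Proof.
move=> GD Gc dGc; apply/is_derive_epsP => e e0.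
(* 32 is 16 from [oint_bound] times 2 from [mean_value_bound]. *)
have e32 : 0 < e / 32 by rewrite divr_gt0.
have dGu := diamond_uniform dGc e32.
pose P (z : C) := [/\ forall x, diamond x -> is_derive z 1 (fun z => G z x) (dG z x),
  cont_on (@diamond R) (G z) & forall x, diamond x -> `|dG z0 x - dG z x| < e / 32].
have : \forall z \near z0, P z by apply: filterS3 GD Gc dGu => z.
move=> /nbhs_normP[d /= d0 Hd].
suff key (h : C) : `|h| < d ->
    `|oint (G (z0 + h *: 1)) - oint (G z0) - h *: oint (dG z0)| <= e * `|h|.
  near=> h; apply: key; rewrite -normrN -sub0r; near: h; exact: near_distC.
move=> hd.
rewrite -[h *: 1]/(h * 1) -[h *: _]/(h * _) mulr1.
have Hs z : seg z0 (z0 + h) z -> ball_ Num.norm z0 d z.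
  move=> zs; rewrite /= -normrN opprB (le_lt_trans _ hd)//; apply: norm_seg zs _ _.
    by rewrite subrr normr0.
  by rewrite [z0 + h]addrC addrK.
have [_ G0c _] := Hd _ (Hs _ (seg_left _ _)).
have [_ Ghc _] : P (z0 + h).
  by apply/Hd/Hs; rewrite -segC; exact: seg_left.
have dG0c : cont_on (@diamond R) (dG z0) by move=> z Gz; apply: joint_slice; exact: dGc.
have Dc : cont_on (@diamond R) (fun z => -1 * G z0 z + G (z0 + h) z).
  move=> z Gz; apply: (@continuousD _ _ _ (fun z => -1 * G z0 z) (G (z0 + h))).
    by apply: (@continuousM _ _ (cst (-1)) (G z0)); [exact: cst_continuous|exact: G0c].
  exact: Ghc.
have -> : oint (G (z0 + h)) - oint (G z0) - h * oint (dG z0) =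
    oint (fun z => - h * dG z0 z + (-1 * G z0 z + G (z0 + h) z)).
  by rewrite !oint_lin//; ring.
have -> : e * `|h| = 16 * (2 * (e / 32) * `|z0 + h - z0|).
  by rewrite [z0 + h]addrC addrK; field.
apply: oint_bound => x Gx.
  apply: (@continuousD _ _ _ (fun z => - h * dG z0 z)
    (fun z => -1 * G z0 z + G (z0 + h) z)); last exact: Dc.
  by apply: (@continuousM _ _ (cst (- h)) (dG z0)); [exact: cst_continuous|exact: dG0c].
have -> : - h * dG z0 x + (-1 * G z0 x + G (z0 + h) x) =
    (G (z0 + h) x + - dG z0 x * (z0 + h)) - (G z0 x + - dG z0 x * z0) by ring.
apply: (@mean_value_bound R z0 (z0 + h) (fun z => dG z x + - dG z0 x)
  (fun z => G z x + - dG z0 x * z)) => z /Hs/Hd[H1 _ H3].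
  have := is_deriveD (H1 x Gx) (is_deriveZ (- dG z0 x) (is_derive_id z 1)).
  by move/is_derive_eq; apply; rewrite -[_ *: _]/(_ * _) mulr1.
by rewrite distrC ltW// H3.
Unshelve. all: by end_near.
Qed.

End ContourParameter.

Section CauchyFormula.
Variable R : realType.
Local Notation C := (Cplx R).
Implicit Types (a b c z w : C) (f g : C -> C).

Lemma is_derive_affine_comp f (a b l z : C) :
  is_derive (a + z * b) 1 f l -> is_derive z 1 (fun z => f (a + z * b)) (l * b).
Proof.
move=> /(@is_derive_dir _ _ _ b) /is_derive_epsP H; apply/is_derive_epsP => e e0.
have := H e e0; apply: filterS => h.
by rewrite -[h *: 1]/(h * 1) mulr1 mulrDl addrA.
Qed.

Lemma is_deriveMr1 f g z (df dg : C) : is_derive z 1 f df -> is_derive z 1 g dg ->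
  is_derive z 1 (fun z => f z * g z) (df * g z + f z * dg).
Proof.
move=> Hf Hg; have /is_derive_eq := is_deriveM Hf Hg; apply.
by rewrite -![_ *: _]/(_ * _); ring.
Qed.

Lemma is_deriveMc f z (df c : C) : is_derive z 1 f df ->
  is_derive z 1 (fun z => f z * c) (df * c).
Proof.
move=> Hf; have /is_derive_eq := is_deriveMr1 Hf (is_derive_cst c z 1); apply.
by rewrite mulr0 addr0.
Qed.

Section Primitive.
Variables (F f : C -> C) (w : C) (s : R).
Hypothesis FD : forall z, `|z - w| < toC s -> is_derive z 1 F (f z).
Hypothesis fC : forall z, `|z - w| < toC s -> {for z, continuous f}.

Let inb (r z : C) : `|r| < toC s -> diamond z -> `|w + r * z - w| < toC s.
Proof.
move=> rs /diamond_norm z1; rewrite [w + _]addrC addrK normrM.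
by rewrite (le_lt_trans _ rs)// ler_piMr.
Qed.

Let inv_at z : diamond z -> {for z, continuous (fun z : C => z^-1)}.
Proof. exact: inv_continuous_on. Qed.

Let inv2_at z : diamond z -> {for z, continuous (fun z : C => z ^- 2)}.
Proof. exact: inv_sqr_continuous_on. Qed.

Let joint (k g : C -> C) (r z : C) : (forall z, `|z - w| < toC s -> {for z, continuous g}) ->
  `|r| < toC s -> diamond z -> {for z, continuous k} ->
  {for (r, z), continuous (fun x : C * C => g (w + x.1 * x.2) * k x.2)}.
Proof.
move=> gc rs Gz kc.
have Lc : {for (r, z), continuous (fun x : C * C => w + x.1 * x.2)}.
  apply: (@continuousD _ _ _ (cst w) (fun x : C * C => x.1 * x.2)).
    exact: cst_continuous.
  by apply: (@continuousM _ _ fst snd); [exact: cvg_fst|exact: cvg_snd].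
exact: (@joint_kernel R C C _ g k (r, z) Lc (gc _ (inb rs Gz)) kc).
Qed.

Let FC z : `|z - w| < toC s -> {for z, continuous F}.
Proof. by move=> /FD[+ _] => /derivable_continuous. Qed.

Let K r := oint (fun z => F (w + r * z) * z ^- 2).
Let M r := oint (fun z => f (w + r * z) * z^-1).

Let near_s (r : C) : `|r| < toC s -> \forall r' \near r, `|r' : C| < toC s.
Proof.
move=> rs; have d0 : 0 < toC s - `|r| by rewrite subr_gt0.
apply: filterS (near_distC r d0) => r' H.
rewrite -(subrK r r') (le_lt_trans (ler_normD _ _))// -ltrBrDr.
by rewrite -normrN opprB.
Qed.

Let KD (r : C) : `|r| < toC s -> is_derive r 1 K (M r).
Proof.
move=> rs.
apply: (@oint_derive R (fun r z => F (w + r * z) * z ^- 2) (fun r z => f (w + r * z) * z^-1)).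
- apply: filterS (near_s rs) => r' r's x Gx.
  have := is_deriveMc (x ^- 2) (is_derive_affine_comp (FD (inb r's Gx))).
  by move=> /is_derive_eq; apply; field; exact: diamond_neq0.
- apply: filterS (near_s rs) => r' r's x Gx.
  have := joint FC r's Gx (inv2_at Gx).
  exact: (@joint_slice R C (fun r z => F (w + r * z) * z ^- 2)).
- by move=> z Gz; exact: (joint fC rs Gz (inv_at Gz)).
Qed.

(** The difference is the integral over a closed contour of the derivative of [F (w + r z) / z] with
    respect to [z]. *)
Let MK (r : C) : `|r| < toC s -> r * M r = K r.
Proof.
move=> rs; apply/eqP; rewrite -subr_eq0; apply/eqP.
have Mc : cont_on (@diamond R) (fun z => f (w + r * z) * z^-1).
  move=> z Gz; have := joint fC rs Gz (inv_at Gz).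
  exact: (@joint_slice R C (fun r z => f (w + r * z) * z ^- 1)).
have Kc : cont_on (@diamond R) (fun z => F (w + r * z) * z^-2).
  move=> z Gz; have := joint FC rs Gz (inv2_at Gz).
  exact: (@joint_slice R C (fun r z => F (w + r * z) * z ^- 2)).
have -> : r * M r - K r = - (-r * M r + K r) by ring.
have nKc : cont_on (@diamond R) (fun z => -1 * (F (w + r * z) * z^-2)).
  move=> z Gz; apply: (@continuousM _ _ (cst (-1)) (fun z => F (w + r * z) * z^-2)).
    exact: cst_continuous.
  exact: Kc.
have -> : - (- r * M r + K r) = r * M r + oint (fun z => -1 * (F (w + r * z) * z^-2)).
  by rewrite ointZ// /K; ring.
rewrite -oint_lin//.
apply: (@oint_ftc R _ (fun z => F (w + z * r) * z^-1)) => z Gz.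
have H : `|w + z * r - w| < toC s by rewrite mulrC; exact: inb.
have z0 := diamond_neq0 Gz.
have := is_deriveMr1 (is_derive_affine_comp (FD H)) (is_derive_inv z0).
by move=> /is_derive_eq; apply; rewrite [z * r]mulrC; field.
Qed.

(** Being homogeneous along rays, [K] is determined by its first-order behaviour at 0, where
    [K 0 = 0] and the derivative is [M 0 = oint_inv R * f w]. *)
Lemma cauchy_primitive (r : C) : `|r| < toC s ->
  oint (fun z => F (w + r * z) * z ^- 2) = oint_inv R * r * f w.
Proof.
move=> rs; rewrite -/(K r).
have s0 : 0 < toC s by rewrite (le_lt_trans (normr_ge0 r)).
have w0 : `|w - w| < toC s by rewrite subrr normr0.
have K0 : K 0 = 0.
  have -> : K 0 = F w * oint (fun z : C => z ^- 2).
    rewrite -ointZ; last exact: inv_sqr_continuous_on.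
    by apply: oint_ext => z _; rewrite mul0r addr0.
  by rewrite oint_inv_sqr mulr0.
have M0 : M 0 = oint_inv R * f w.
  rewrite mulrC -ointZ; last exact: inv_continuous_on.
  by apply: oint_ext => z _; rewrite mul0r addr0.
have [->|r0] := eqVneq r 0; first by rewrite K0 mulr0 mul0r.
(* [K r / r] is constant on the ray through [r] because [r K'(r) = K r] *)
have Kt (t : R) : 0 < t -> t <= 1 -> K (toC t * r) = toC t * K r.
  move=> t0 t1; have tn0 : toC t != 0 by rewrite lt0r_neq0// toC_gt0.
  have tr z : seg (toC t * r) r z -> z != 0 /\ `|z| < toC s.
    move=> zs; split; last first.
      rewrite -[z]subr0 (le_lt_trans _ rs)//; apply: norm_seg zs _ _; rewrite subr0//.
      by rewrite normrM norm_toC ler_piMl// -toC1 ler_toC ger0_norm// ltW.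
    move: zs => [u /andP[u0 u1] ->]; rewrite segptE mulrA -toCM -mulrDl -toCD.
    rewrite mulf_neq0// lt0r_neq0// toC_gt0.
    have : 0 <= (1 - u) * t by rewrite mulr_ge0 ?subr_ge0// ltW.
    by nra.
  have D z : seg (toC t * r) r z -> is_derive z 1 (fun z => K z * z^-1) 0.
    move=> /tr[z0 zs].
    have := is_deriveMr1 (KD zs) (is_derive_inv z0).
    by move=> /is_derive_eq; apply; rewrite -(MK zs); field.
  have n00 : `|0 : C| <= 0 by rewrite normr0.
  have := mean_value_bound D (fun z _ => n00); rewrite mulr0 mul0r.
  rewrite normr_le0 subr_eq0 => /eqP E.
  have -> : K (toC t * r) = K (toC t * r) * (toC t * r)^-1 * (toC t * r).
    by rewrite mulfVK// mulf_neq0.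
  by rewrite -E; field.
have n0s : `|0 : C| < toC s by rewrite normr0.
have /is_derive_epsP HD := KD n0s.
apply/eqP; rewrite -subr_eq0 -normr_le0; apply/ler_addgt0Pl => e e0; rewrite addr0.
have er : 0 < e / `|r| by rewrite divr_gt0// normr_gt0.
have /nbhs_normP[d /= d0 Hd] := HD _ er.
have [n nd] := exists_pow2_gt (normr_ge0 r) d0.
(* The expansion of [K] at 0 is evaluated at [t r]; dividing it by [t] leads back to [r] with error
   at most [e]. *)
pose t : R := 2^-1 ^+ n.
have t0 : 0 < t by rewrite exprn_gt0// invr_gt0.
have t1 : t <= 1 by rewrite exprn_ile1// ?invr_ge0// invf_le1// ler1n.
have tE : toC t = (2 ^+ n)^-1 by rewrite /t exprVn toCV -natrX toC_nat natrX.
have tn : `|toC t| = toC t by rewrite norm_toC ger0_norm// ltW.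
have /= := Hd (toC t * r); rewrite sub0r normrN normrM tn tE mulrC => /(_ nd).
rewrite -tE K0 M0 subr0 -[(toC t * r) *: 1]/(toC t * r * 1) mulr1 add0r.
rewrite -[_ *: _]/(toC t * r * (oint_inv R * f w)) Kt//.
have -> : toC t * K r - toC t * r * (oint_inv R * f w) = toC t * (K r - oint_inv R * r * f w).
  by ring.
rewrite normrM tn.
have -> : e / `|r| * (`|r| * toC t) = toC t * e by rewrite mulrA divfK ?normr_eq0// mulrC.
by rewrite ler_pM2l// toC_gt0.
Qed.

End Primitive.

Lemma cauchy_derive f w (s : R) (r : C) : 0 < s ->
  (forall z, `|z - w| < toC (6 * s) -> derivable f z 1) -> `|r| < toC s ->
  oint (fun z => f (w + r * z) * z ^- 2) = oint_inv R * r * 'D_1 f w.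
Proof.
move=> s0 fD rs.
(* Points [v + r z] with [v] within [s] of [w] stay within [2 s]. The square of half-side [2 s] lies
   in the disc of radius [4 s], hence inside the domain of radius [6 s]. *)
have [|z /square_ball zb|F FD] := @holo_primitive R w (2 * s) f.
- by rewrite mulr_gt0.
- by apply: fD; rewrite (le_lt_trans zb)// ltr_toC; lra.
have fC z : `|z - w| < toC (2 * s) -> {for z, continuous f}.
  by move=> zb; apply: derivable_continuous; apply: fD; rewrite (lt_le_trans zb)// ler_toC; lra.
pose G (v z : C) := F (v + r * z) * z ^- 2.
pose dG (v z : C) := f (v + r * z) * z ^- 2.
have s0' : 0 < toC s by rewrite toC_gt0.
have shift v z : `|w - v| < toC s -> `|z - v| < toC s -> `|z - w| < toC (2 * s).
  move=> vw zv; rewrite mulrDl mul1r toCD -(subrK v z) -addrA.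
  by rewrite (le_lt_trans (ler_normD _ _))// ltrD// distrC.
have inb v z : `|w - v| < toC s -> diamond z -> `|v + r * z - w| < toC (2 * s).
  move=> vw /diamond_norm z1; apply: (shift v) => //.
  by rewrite [v + _]addrC addrK normrM (le_lt_trans _ rs)// ler_piMr.
have GE : \forall v \near w, oint (G v) = oint_inv R * r * f v.
  apply: filterS (near_distC w s0') => v vw.
  exact: (cauchy_primitive (fun z zv => FD z (shift v z vw zv))
    (fun z zv => fC z (shift v z vw zv)) rs).
have FC z : `|z - w| < toC (2 * s) -> {for z, continuous F}.
  by move=> /FD[+ _] => /derivable_continuous.
have joint (g : C -> C) v z : (forall z, `|z - w| < toC (2 * s) -> {for z, continuous g}) ->
    `|w - v| < toC s -> diamond z ->
    {for (v, z), continuous (fun x : C * C => g (x.1 + r * x.2) * x.2 ^- 2)}.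
  move=> gc vw Gz.
  have Lc : {for (v, z), continuous (fun x : C * C => x.1 + r * x.2)}.
    apply: (@continuousD _ _ _ fst (fun x : C * C => r * x.2)); first exact: cvg_fst.
    by apply: (@continuousM _ _ (cst r) snd); [exact: cst_continuous|exact: cvg_snd].
  exact: (@joint_kernel R C C _ g (fun z => z ^- 2) (v, z) Lc (gc _ (inb _ _ vw Gz))
    (inv_sqr_continuous_on Gz)).
have H : is_derive w 1 (fun v => oint (G v)) (oint (dG w)).
  apply: (@oint_derive R G dG).
  - apply: filterS (near_distC w s0') => v vw z Gz.
    have := @is_derive_affine_comp F (r * z) 1 (f (r * z + v * 1)) v.
    rewrite mulr1 [r * z + v]addrC => /(_ (FD _ (inb _ _ vw Gz))) H.
    have := is_deriveMc (z ^- 2) H; rewrite mulr1 /G /dG.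
    by under eq_fun do rewrite mulr1 addrC.
  - apply: filterS (near_distC w s0') => v vw z Gz.
    have := joint _ _ _ FC vw Gz; exact: (@joint_slice R C G).
  - have ww : `|w - w| < toC s by rewrite subrr normr0.
    by move=> z Gz; exact: (joint f w z fC ww Gz).
have fw : derivable f w 1 by apply: fD; rewrite subrr normr0 toC_gt0 mulr_gt0.
have H2 : is_derive w 1 (fun v => oint_inv R * r * f v) (oint_inv R * r * 'D_1 f w).
  exact: (is_deriveZ (oint_inv R * r) (derivableP fw)).
have H3 := near_eq_is_derive GE H.
by have [_ <-] := H2; have [_ <-] := H3.
Qed.

End CauchyFormula.

(** * Mixed derivatives *)

Section Mixed.
Variables (R : realType).
Local Notation C := (Cplx R).
Variable V : normedModType C.
Implicit Types (x q p u v : V).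

Lemma is_derive_along (g : V -> C) q v (z l : C) :
  is_derive (q + z *: v) v g l -> is_derive z 1 (fun z => g (q + z *: v)) l.
Proof.
move=> /is_derive_epsP H; apply/is_derive_epsP => e e0.
have := H e e0; apply: filterS => h.
by rewrite -[h *: (1 : C)]/(h * 1) mulr1 scalerDl addrA.
Qed.

Lemma is_derive_along_inv (g : V -> C) q v (l : C) :
  is_derive (0 : C) 1 (fun z => g (q + z *: v)) l -> is_derive q v g l.
Proof.
move=> /is_derive_epsP H; apply/is_derive_epsP => e e0.
have := H e e0; apply: filterS => h.
by rewrite -[h *: (1 : C)]/(h * 1) mulr1 scale0r addr0 add0r.
Qed.

Lemma cauchy_dir (g : V -> C) q v (s : R) (r : C) : 0 < s ->
  (forall z : C, `|z| < toC (6 * s) -> derivable g (q + z *: v) v) -> `|r| < toC s ->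
  oint (fun z => g (q + (r * z) *: v) * z ^- 2) = oint_inv R * r * 'D_v g q.
Proof.
move=> s0 gD rs.
have D (z : C) : `|z| < toC (6 * s) ->
    is_derive z 1 (fun z : C => g (q + z *: v)) ('D_v g (q + z *: v)).
  by move=> zs; apply: is_derive_along; apply: derivableP; exact: gD.
have := @cauchy_derive R (fun z : C => g (q + z *: v)) 0 s r s0.
have H0 (z : C) : `|z - 0| < toC (6 * s) -> derivable (fun z : C => g (q + z *: v)) z 1.
  by rewrite subr0 => /D[].
move=> /(_ H0 rs); under oint_ext do rewrite add0r.
have n0 : `|0 : C| < toC (6 * s) by rewrite normr0 toC_gt0 mulr_gt0.
by have [_ E] := D 0 n0; rewrite E scale0r addr0.
Qed.

Section Ball.
Variables (phi : V -> C) (p : V) (d : C).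
Hypothesis d0 : 0 < d.
Hypothesis phiD : forall x, `|x - p| < d -> differentiable phi x.

(** Moving by [z v] with [|z| < 6 s] then costs less than [d / 4], so points within [d / 2] of [p]
    stay in the ball of radius [d]. Dividing by [|v| + 1] allows [v = 0]. *)
Let rad_exists v : exists s : R, 0 < s /\ toC (6 * s) * `|v| < d / 4.
Proof.
have v1 : 0 < `|v| + 1 by rewrite ltr_wpDl.
have e0 : 0 < d / 4 / 6 / (`|v| + 1) by rewrite !divr_gt0.
exists (ReC (d / 4 / 6 / (`|v| + 1))); split; first exact: gt0_ReC.
rewrite toCM -(gt0_toC e0) toC_nat.
have -> : 6 * (d / 4 / 6 / (`|v| + 1)) * `|v| = d / 4 * (`|v| / (`|v| + 1)).
  by field; exact: lt0r_neq0.
by rewrite gtr_pMr ?divr_gt0// ltr_pdivrMr// mul1r ltrDl.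
Qed.

Let near_ball q v (s : R) (z : C) (e : C) : toC (6 * s) * `|v| < d / 4 ->
  `|q - p| < e -> `|z| < toC (6 * s) -> `|q + z *: v - p| < e + d / 4.
Proof.
move=> sv qp zs; rewrite addrAC (le_lt_trans (ler_normD _ _))// ltrD//.
by rewrite normrZ (le_lt_trans _ sv)// ler_wpM2r// ltW.
Qed.

Let d4d : d / 2 + d / 4 < d.
Proof.
rewrite -subr_gt0; have -> : d - (d / 2 + d / 4) = d / 4 by field.
by rewrite divr_gt0.
Qed.

Let le6 (s : R) (z : C) : 0 < s -> `|z| < toC s -> `|z| < toC (6 * s).
Proof. by move=> s0 zs; rewrite (lt_le_trans zs)// ler_toC; lra. Qed.

Let gam6 (s : R) (r z : C) : 0 < s -> `|r| < toC s -> diamond z -> `|r * z| < toC (6 * s).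
Proof.
move=> s0 rs /diamond_norm z1; apply: le6 => //.
by rewrite normrM (le_lt_trans _ rs)// ler_piMr.
Qed.

Let shift_continuous (g : V -> C) v q (r z : C) :
  {for q + (r * z) *: v, continuous g} -> diamond z ->
  {for (q, z), continuous (fun x : V * C => g (x.1 + (r * x.2) *: v) * x.2 ^- 2)}.
Proof.
move=> gc Gz.
have Lc : {for (q, z), continuous (fun x : V * C => x.1 + (r * x.2) *: v)}.
  apply: (@continuousD _ _ _ fst (fun x : V * C => (r * x.2) *: v)).
    exact: cvg_fst.
  apply: (@cvgZr_tmp _ _ _ _ _ (fun x : V * C => r * x.2)).
  by apply: (@continuousM _ _ (cst r) snd); [exact: cst_continuous|exact: cvg_snd].
exact: (@joint_kernel R V V _ g (fun z => z ^- 2) (q, z) Lc gc (inv_sqr_continuous_on Gz)).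
Qed.

Let partial_formula q v (s : R) (r : C) : 0 < s -> toC (6 * s) * `|v| < d / 4 ->
  `|q - p| < d / 2 -> `|r| < toC s ->
  oint (fun z => phi (q + (r * z) *: v) * z ^- 2) = oint_inv R * r * 'D_v phi q.
Proof.
move=> s0 sv qp rs; apply: (cauchy_dir s0) rs => z zs.
apply: diff_derivable; apply: phiD.
exact: lt_trans (near_ball sv qp zs) d4d.
Qed.

Let near_le x (e : C) : `|x - p| < e -> \forall y \near x, `|y - p| < e.
Proof.
move=> xp; have e0 : 0 < e - `|x - p| by rewrite subr_gt0.
apply: filterS (near_dist_lt x e0) => y H.
rewrite -(subrK x y) -addrA (le_lt_trans (ler_normD _ _))// -ltrBrDr.
by rewrite distrC.
Qed.

Let half_s (s : R) : 0 < s -> 0 < toC (s / 2) /\ `|toC (s / 2)| < toC s.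
Proof.
move=> s0; rewrite toC_gt0 norm_toC ltr_toC ger0_norm; last by lra.
by split; lra.
Qed.

(** Near [x] the derivative is a constant multiple of an integral of [phi], which depends
    continuously on its base point. This supplies the joint continuity that [oint_derive] asks
    for. *)
Let partial_continuous x v : `|x - p| < d / 2 -> {for x, continuous ('D_v phi)}.
Proof.
move=> xp; have [s [s0 sv]] := rad_exists v.
have [r0 rs] := half_s s0; set r := toC (s / 2) in r0 rs.
have cr : oint_inv R * r != 0 by rewrite mulf_neq0 ?oint_inv_neq0// lt0r_neq0.
have phic q z : `|q - p| < d / 2 -> diamond z -> {for q + (r * z) *: v, continuous phi}.
  move=> qp Gz; apply: differentiable_continuous; apply: phiD.
  exact: lt_trans (near_ball sv qp (gam6 s0 rs Gz)) d4d.
have Lc : {for x, continuous (fun q => oint (fun z => phi (q + (r * z) *: v) * z ^- 2))}.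
  apply: (@oint_continuous R V (fun q z => phi (q + (r * z) *: v) * z ^- 2)).
    apply: filterS (near_le xp) => q qp z Gz.
    have := shift_continuous (phic q z qp Gz) Gz.
    exact: (@joint_slice R V (fun q z => phi (q + (r * z) *: v) * z ^- 2)).
  by move=> z Gz; exact: shift_continuous (phic x z xp Gz) Gz.
have Lc' : {for x, continuous (fun q => (oint_inv R * r)^-1 *
    oint (fun z => phi (q + (r * z) *: v) * z ^- 2))}.
  have cc : {for x, continuous (cst (oint_inv R * r)^-1 : V -> C)} by exact: cst_continuous.
  exact: (continuousM cc Lc).
apply/continuous_atP => e e0.
have /continuous_atP/(_ e e0) := Lc'.
have E q : `|q - p| < d / 2 ->
    (oint_inv R * r)^-1 * oint (fun z => phi (q + (r * z) *: v) * z ^- 2) = 'D_v phi q.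
  by move=> qp; rewrite (partial_formula s0 sv qp rs) (mulKf cr).
apply: filterS2 (near_le xp) => q qp.
by rewrite (E x xp) (E q qp).
Qed.

(** For [x] within [d / 4] of [p] the shifted points stay within [d / 2], where ['D_u phi] is known
    to be continuous. *)
Let partial_derive x u v (s : R) (r : C) : 0 < s -> toC (6 * s) * `|v| < d / 4 ->
  `|x - p| < d / 4 -> `|r| < toC s -> oint_inv R * r != 0 ->
  is_derive x u ('D_v phi)
    ((oint_inv R * r)^-1 * oint (fun z => 'D_u phi (x + (r * z) *: v) * z ^- 2)).
Proof.
move=> s0 sv xp rs cr.
have d42 : d / 4 + d / 4 = d / 2 by field.
have lt42 : d / 4 < d / 2 by rewrite -d42 ltrDl divr_gt0.
have near0 : \forall z \near (0 : C), `|x + z *: u - p| < d / 4.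
  have := near_le xp.
  have uc : {for (0 : C), continuous (fun z : C => x + z *: u)}.
    apply: (@continuousD _ _ _ (cst x) (fun z : C => z *: u)); first exact: cst_continuous.
    exact: scalel_continuous.
  by rewrite -{1}[x]addr0 -{1}(scale0r u) => /uc.
pose G (w z : C) := phi (x + w *: u + (r * z) *: v) * z ^- 2.
pose dG (w z : C) := 'D_u phi (x + w *: u + (r * z) *: v) * z ^- 2.
have inb q z : `|q - p| < d / 4 -> diamond z -> `|q + (r * z) *: v - p| < d / 2.
  by move=> qp Gz; rewrite -d42; exact: near_ball sv qp (gam6 s0 rs Gz).
have lt2d : d / 2 < d by rewrite (lt_trans _ d4d)// ltrDl divr_gt0.
have H : is_derive (0 : C) 1 (fun w => oint (G w)) (oint (dG 0)).
  apply: (@oint_derive R G dG).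
  - apply: filterS near0 => w wp z Gz.
    apply: is_deriveMc.
    have phid : differentiable phi (x + w *: u + (r * z) *: v).
      by apply: phiD; rewrite (lt_trans _ lt2d)//; exact: inb.
    have E w' : x + w' *: u + (r * z) *: v = x + (r * z) *: v + w' *: u by rewrite addrAC.
    rewrite E in phid *; under eq_fun do rewrite E.
    by apply: is_derive_along; apply: derivableP; exact: diff_derivable.
  - apply: filterS near0 => w wp z Gz.
    have pc : {for x + w *: u + (r * z) *: v, continuous phi}.
      apply: differentiable_continuous; apply: phiD; rewrite (lt_trans _ lt2d)//; exact: inb.
    have := shift_continuous pc Gz.
    exact: (@joint_slice R V (fun q z => phi (q + (r * z) *: v) * z ^- 2)).
  - move=> z Gz.
    have x0p : `|x + (0 : C) *: u - p| < d / 4 by rewrite scale0r addr0.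
    have pc : {for x + (0 : C) *: u + (r * z) *: v, continuous ('D_u phi)}.
      by apply: partial_continuous; exact: inb.
    have Lc : {for ((0 : C), z), continuous (fun y : C * C => (x + y.1 *: u, y.2))}.
      apply: continuous_pair; last exact: cvg_snd.
      apply: (@continuousD _ _ _ (cst x) (fun y : C * C => y.1 *: u)).
        exact: cst_continuous.
      by apply: (@cvgZr_tmp _ _ _ _ _ fst); exact: cvg_fst.
    exact: (continuous_at_comp Lc (shift_continuous pc Gz)).
apply: is_derive_along_inv.
have GE : \forall w \near (0 : C), (oint_inv R * r)^-1 * oint (G w) = 'D_v phi (x + w *: u).
  apply: filterS near0 => w wp; rewrite /G.
  by rewrite (partial_formula s0 sv (lt_trans wp lt42) rs) (mulKf cr).
have -> : oint (fun z => 'D_u phi (x + (r * z) *: v) * z ^- 2) = oint (dG 0).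
  by apply: oint_ext => z _; rewrite /dG scale0r addr0.
exact: (near_eq_is_derive GE).
Qed.

Lemma mixed_partials_ball u v :
  derivable ('D_v phi) p u /\ 'D_u ('D_v phi) p = 'D_v ('D_u phi) p.
Proof.
have [s [s0 sv]] := rad_exists v.
have [r0 rs] := half_s s0; set r := toC (s / 2) in r0 rs.
have cr : oint_inv R * r != 0 by rewrite mulf_neq0 ?oint_inv_neq0// lt0r_neq0.
have pp : `|p - p| < d / 4 by rewrite subrr normr0 divr_gt0.
have [Dv Ev] := partial_derive u s0 sv pp rs cr.
split; first exact: Dv.
apply: (etrans Ev).
have [s' [s'0 s'u]] := rad_exists u.
have [r'0 r's] := half_s s'0; set r' := toC (s' / 2) in r'0 r's.
have cr' : oint_inv R * r' != 0 by rewrite mulf_neq0 ?oint_inv_neq0// lt0r_neq0.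
(* [partial_derive] with [u] and [v] exchanged makes ['D_u phi] derivable along [v], so Cauchy's
   formula applies to it. *)
have gD (z : C) : `|z| < toC (6 * s) -> derivable ('D_u phi) (p + z *: v) v.
  move=> zs; have zp : `|p + z *: v - p| < d / 4.
    rewrite [p + _]addrC addrK normrZ (le_lt_trans _ sv)// ler_wpM2r// ltW//.
  by have [] := partial_derive v s'0 s'u zp r's cr'.
by rewrite (cauchy_dir s0 gD rs) (mulKf cr).
Qed.

End Ball.

Lemma mixed_partials (phi : V -> C) p u v : (\forall x \near p, differentiable phi x) ->
  derivable ('D_v phi) p u /\ 'D_u ('D_v phi) p = 'D_v ('D_u phi) p.
Proof.
move=> /nbhs_normP[d /= d0 Hd]; apply: (mixed_partials_ball d0) => x xp.
by apply: Hd; rewrite /= distrC.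
Qed.

End Mixed.

(** * The ansatz *)

Section Frame.
Variable R : realType.
Local Notation C := (Cplx R).
Local Notation H := 'rV[Cplx R]_5.
Implicit Types (p q u v w : H).

Lemma is_derive_coord p u (k : 'I_5) : is_derive p u (fun q : H => q 0 k) (u 0 k).
Proof.
apply/is_derive_epsP => e e0; near=> h.
rewrite !mxE -[_ *: _]/(h * u 0 k) [p 0 k + _]addrC addrK subrr normr0.
by rewrite mulr_ge0// ltW.
Unshelve. all: by end_near.
Qed.

Lemma is_deriveMf (V : normedModType C) (f g : V -> C) (p u : V) (df dg : C) :
  is_derive p u f df -> is_derive p u g dg ->
  is_derive p u (fun q : V => f q * g q) (df * g p + f p * dg).
Proof.
move=> Hf Hg; have /is_derive_eq := is_deriveM Hf Hg; apply.
by rewrite -![_ *: _]/(_ * _); ring.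
Qed.

Lemma is_deriveVf (V : normedModType C) (f : V -> C) (p u : V) (df : C) :
  f p != 0 -> is_derive p u f df ->
  is_derive p u (fun q : V => (f q)^-1) (- (f p) ^- 2 * df).
Proof.
move=> f0 [Df <-]; split; first exact: derivableV.
by rewrite deriveV.
Qed.

Lemma is_derive_lin2 (V : normedModType C) (f g : V -> C) (p u : V) (df dg a b : C) :
  is_derive p u f df -> is_derive p u g dg ->
  is_derive p u (fun q : V => f q * a + g q * b) (df * a + dg * b).
Proof.
move=> Hf Hg.
have := is_deriveD (is_deriveMf Hf (is_derive_cst a p u)) (is_deriveMf Hg (is_derive_cst b p u)).
by move=> /is_derive_eq; apply; rewrite /cst; ring.
Qed.

Lemma is_derive_linear (f : H -> C) p (a b : C) u v : differentiable f p ->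
  'D_(a *: u + b *: v) f p = a * 'D_u f p + b * 'D_v f p.
Proof. by move=> fp; rewrite !deriveE// linearD !linearZ. Qed.

(** The common shape of the four horizontal fields, so that derivatives and commutators are computed
    once. *)
Definition hfield (i : 'I_5) (s : C) (k : 'I_5) : @vfield R :=
  fun q => dcoord i + (s * q 0 k) *: dcoord 4.

Lemma V00E : @V00 R = hfield 0 (-1) 3.
Proof. by apply/funext => q; rewrite /hfield mulN1r scaleNr. Qed.
Lemma V10E : @V10 R = hfield 1 (-1) 2.
Proof. by apply/funext => q; rewrite /hfield mulN1r scaleNr. Qed.
Lemma V01E : @V01 R = hfield 2 1 1.
Proof. by apply/funext => q; rewrite /hfield mul1r. Qed.
Lemma V11E : @V11 R = hfield 3 1 0.
Proof. by apply/funext => q; rewrite /hfield mul1r. Qed.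

Definition pderive (phi : H -> C) (i : 'I_5) : H -> C := 'D_(dcoord i) phi.
Definition pderive2 (phi : H -> C) p u i : C := 'D_u (pderive phi i) p.

Section Point.
Variables (phi : H -> C) (p : H).
Hypothesis phiD : \forall q \near p, differentiable phi q.

Local Notation g i := (pderive phi i).
Local Notation D2 u i := (pderive2 phi p u i).

Lemma D2_derive u i : is_derive p u (g i) (D2 u i).
Proof. by apply: derivableP; have [] := mixed_partials u (dcoord i) phiD. Qed.

(** By symmetry [u] may be taken as the inner direction, and there linearity follows from the
    differentiability of [phi] near [p]. *)
Lemma D2_lin u v (a b : C) i : D2 (a *: u + b *: v) i = a * D2 u i + b * D2 v i.
Proof.
have sym w : D2 w i = 'D_(dcoord i) ('D_w phi) p.
  by have [_ E] := mixed_partials w (dcoord i) phiD; exact: E.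
have Dw w : is_derive p (dcoord i) ('D_w phi) (D2 w i).
  by rewrite sym; apply: derivableP; have [] := mixed_partials (dcoord i) w phiD.
have E : \forall q \near p, a * 'D_u phi q + b * 'D_v phi q = 'D_(a *: u + b *: v) phi q.
  by apply: filterS phiD => q fq; rewrite is_derive_linear.
have H1 := is_deriveD (is_deriveZ a (Dw u)) (is_deriveZ b (Dw v)).
have [_ H2] := near_eq_is_derive E H1.
by rewrite sym H2.
Qed.

Lemma D2_sym i j : D2 (dcoord i) j = D2 (dcoord j) i.
Proof. by have [_ E] := mixed_partials (dcoord i) (dcoord j) phiD; exact: E. Qed.

Lemma act_hfield i s k : \forall q \near p, g i q + s * q 0 k * g 4 q = act (hfield i s k) phi q.
Proof.
apply: filterS phiD => q fq; rewrite /act /hfield.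
by rewrite -[dcoord i]scale1r is_derive_linear// mul1r.
Qed.

Lemma is_derive_act i s k u :
  is_derive p u (act (hfield i s k) phi)
    (D2 u i + s * (u 0 k * g 4 p + p 0 k * D2 u 4)).
Proof.
have H1 := is_deriveMf (is_derive_coord p u k) (D2_derive u 4).
have H2 := is_deriveD (D2_derive u i) (is_deriveZ s H1).
have E : g i + s *: (fun q => q 0 k * g 4 q) = (fun q => g i q + s * q 0 k * g 4 q).
  by apply/funext => q /=; rewrite -mulrA.
rewrite E in H2; exact: (near_eq_is_derive (act_hfield i s k) H2).
Qed.

Definition second_act X Y : C := 'D_(X p) (act Y phi) p.

Lemma derive_act_lin i s k u v (a b : C) :
  'D_(a *: u + b *: v) (act (hfield i s k) phi) p =
  a * 'D_u (act (hfield i s k) phi) p + b * 'D_v (act (hfield i s k) phi) p.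
Proof.
have [_ E1] := is_derive_act i s k (a *: u + b *: v).
have [_ E2] := is_derive_act i s k u.
have [_ E3] := is_derive_act i s k v.
apply: (etrans E1); apply: (etrans _ (congr2 (fun x y => a * x + b * y) (esym E2) (esym E3))).
rewrite (D2_lin u v a b i) (D2_lin u v a b 4) !mxE.
move: (D2 u i) (D2 v i) (D2 u 4) (D2 v 4) (g 4 p) => x1 x2 x3 x4 x5.
ring.
Qed.

(** Second-order terms cancel by symmetry; what remains comes from differentiating the coefficients.
    As [k] and [k'] differ from 4, these coefficients do not depend on [t]. *)
Lemma second_act_comm i j s s' k k' : k != 4 -> k' != 4 ->
  second_act (hfield j s' k') (hfield i s k) - second_act (hfield i s k) (hfield j s' k') =
  (s * (j == k)%:R - s' * (i == k')%:R) * act (@VT R) phi p.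
Proof.
move=> k4 k'4; rewrite /second_act.
have [_ E1] := is_derive_act i s k (hfield j s' k' p).
have [_ E2] := is_derive_act j s' k' (hfield i s k p).
apply: (etrans (congr2 (fun x y => x - y) E1 E2)).
have vE i' s1 k1 l : D2 (hfield i' s1 k1 p) l = D2 (dcoord i') l + s1 * p 0 k1 * D2 (dcoord 4) l.
  by rewrite /hfield -[dcoord i' in LHS]scale1r D2_lin mul1r.
have vk i' s1 k1 l : l != 4 -> hfield i' s1 k1 p 0 l = (i' == l)%:R.
  by move=> l4; rewrite /hfield !mxE !eqxx /= (negPf l4) mulr0 addr0 eq_sym.
rewrite !vE !vk// (D2_sym j i) (D2_sym j 4) (D2_sym i 4) -[act _ phi p]/(g 4 p).
move: (D2 (dcoord i) j) (D2 (dcoord 4) i) (D2 (dcoord 4) j) (D2 (dcoord 4) 4) (g 4 p).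
by move=> x1 x2 x3 x4 x5; ring.
Qed.

Lemma is_derive_act_ln i s k u : phi p != 0 ->
  is_derive p u (act_ln (hfield i s k) phi)
    (- (phi p) ^- 2 * 'D_u phi p * act (hfield i s k) phi p +
     (phi p)^-1 * 'D_u (act (hfield i s k) phi) p).
Proof.
move=> p0; have phip : differentiable phi p := nbhs_singleton phiD.
have H1 : is_derive p u phi ('D_u phi p) by apply: derivableP; exact: diff_derivable.
have H2 : is_derive p u (act (hfield i s k) phi) ('D_u (act (hfield i s k) phi) p).
  by apply: derivableP; have [] := is_derive_act i s k u.
exact: (is_deriveMf (is_deriveVf p0 H1) H2).
Qed.

End Point.
End Frame.

(** * Curvature of the ansatz at a point *)

Section AnsatzCurvature.
Variable R : realType.
Local Notation C := (Cplx R).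
Local Notation H := 'rV[Cplx R]_5.
Local Notation M2 := 'M[Cplx R]_2.
Implicit Types (p q u v w : H) (a b c d : C).

Lemma mx22D a b c d a' b' c' d' :
  mx22 a b c d + mx22 a' b' c' d' = mx22 (a + a') (b + b') (c + c') (d + d').
Proof. by apply/matrixP => i j; rewrite !mxE; case: ifP => _; case: ifP. Qed.

Lemma mx22B a b c d a' b' c' d' :
  mx22 a b c d - mx22 a' b' c' d' = mx22 (a - a') (b - b') (c - c') (d - d').
Proof. by apply/matrixP => i j; rewrite !mxE; case: ifP => _; case: ifP. Qed.

Lemma mx22M a b c d a' b' c' d' : mx22 a b c d *m mx22 a' b' c' d' =
  mx22 (a * a' + b * c') (a * b' + b * d') (c * a' + d * c') (c * b' + d * d').
Proof.
apply/matrixP => i j; rewrite !mxE !big_ord_recl big_ord0 !mxE addr0 /=.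
by case: ifP => _; case: ifP.
Qed.

Lemma mx22_eq0 a b c d : a = 0 -> b = 0 -> c = 0 -> d = 0 -> mx22 a b c d = 0 :> M2.
Proof. by move=> -> -> -> ->; apply/matrixP => i j; rewrite !mxE; case: ifP => _; case: ifP. Qed.

Lemma is_derive_scalel (V W : normedModType C) (f : V -> C) (x y : V) (df : C) (w : W) :
  is_derive x y f df -> is_derive x y (fun q : V => f q *: w) (df *: w).
Proof.
move=> /is_derive_epsP Hf; apply/is_derive_epsP => e e0.
have w1 : 0 < `|w| + 1 by rewrite ltr_wpDl.
apply: filterS (Hf _ (divr_gt0 e0 w1)) => h Hh.
rewrite scalerA -!scalerBl normrZ (le_trans (ler_wpM2r (normr_ge0 w) Hh))//.
rewrite mulrAC ler_wpM2r// mulrAC ler_pdivrMr// ler_wpM2l ?ltW// ltrDl.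
exact: ltr01.
Qed.

Lemma is_derive_mx22 (V : normedModType C) (a b c d : V -> C) (x y : V) (a' b' c' d' : C) :
  is_derive x y a a' -> is_derive x y b b' -> is_derive x y c c' -> is_derive x y d d' ->
  is_derive x y (fun q : V => mx22 (a q) (b q) (c q) (d q) : M2) (mx22 a' b' c' d').
Proof.
have E a1 b1 c1 d1 : mx22 a1 b1 c1 d1 = a1 *: (mx22 1 0 0 0 : M2) +
    b1 *: (mx22 0 1 0 0 : M2) + c1 *: (mx22 0 0 1 0 : M2) + d1 *: (mx22 0 0 0 1 : M2).
  apply/matrixP => i j; rewrite !mxE.
  by case: ifP => _; case: ifP => _; rewrite !(mulr0, mulr1, addr0, add0r).
move=> Ha Hb Hc Hd; rewrite E; under eq_fun do rewrite E.
exact: (is_deriveD (is_deriveD (is_deriveD (is_derive_scalel _ Ha) (is_derive_scalel _ Hb))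
  (is_derive_scalel _ Hc)) (is_derive_scalel _ Hd)).
Qed.

(** The derivative along [u] of [theta] evaluated on the constant vector [v]. The exterior
    derivative of [theta] is [dtheta u v - dtheta v u]. *)
Definition dtheta u v : C := u 0 3 * v 0 0 + u 0 2 * v 0 1 - u 0 1 * v 0 2 - u 0 0 * v 0 3.

(* Continuity of [W] suffices because [theta _ v] is affine and vanishes at [p]. *)
Lemma is_derive_theta p u v (W : H -> M2) : theta p v = 0 -> {for p, continuous W} ->
  is_derive p u (fun q => theta q v *: W q) (dtheta u v *: W p).
Proof.
move=> tp Wc; apply/is_derive_epsP => e e0.
have tE h : theta (p + h *: u) v = h * dtheta u v.
  rewrite -[RHS]add0r -tp /theta /dtheta /y00 /y10 /y01 /y11 !mxE; ring.
have w1 : 0 < `|dtheta u v| + 1 by rewrite ltr_wpDl.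
have uc : {for (0 : C), continuous (fun h : C => p + h *: u)}.
  apply: (@continuousD _ _ _ (cst p) (fun h : C => h *: u)); first exact: cst_continuous.
  exact: scalel_continuous.
have Wc0 : {for p + (0 : C) *: u, continuous W} by rewrite scale0r addr0.
have /continuous_atP/(_ _ (divr_gt0 e0 w1)) := continuous_at_comp uc Wc0.
apply: filterS => h; rewrite scale0r addr0 => Hh.
rewrite tE tp scale0r subr0 -scalerA -scalerBr -scalerBr !normrZ mulrC.
rewrite ler_wpM2r// -normrN opprB.
apply: le_trans (ler_wpM2l (normr_ge0 _) (ltW Hh)) _.
rewrite mulrC mulrAC ler_pdivrMr// ler_wpM2l ?ltW// ltrDl.
exact: ltr01.
Qed.

Section Point.
Variables (phi : H -> C) (p : H) (PhiT : H -> M2).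
Hypothesis phiD : \forall q \near p, differentiable phi q.
Hypothesis phi0 : phi p != 0.
Hypothesis PhiTc : {for p, continuous PhiT}.

Definition dact_ln (u : H) (X : @vfield R) : C :=
  - (phi p) ^- 2 * 'D_u phi p * act X phi p + (phi p)^-1 * 'D_u (act X phi) p.

(** The ansatz without its [theta] term. It is linear in the coefficients [A], so one formula serves
    for the values [act_ln] and for their derivatives [dact_ln u]. *)
Definition ansatz_mx (A : @vfield R -> C) (v : H) : M2 :=
  let D := 2^-1 * ((A (@V00 R) * v 0 0 + A (@V10 R) * v 0 1) -
    (A (@V01 R) * v 0 2 + A (@V11 R) * v 0 3)) in
  mx22 D (A (@V01 R) * v 0 0 + A (@V11 R) * v 0 1)
    (A (@V00 R) * v 0 2 + A (@V10 R) * v 0 3) (- D).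

Lemma ansatz_at v : theta p v = 0 ->
  ansatz phi PhiT p v = ansatz_mx (fun X => act_ln X phi p) v.
Proof. by move=> tv; rewrite /ansatz tv scale0r addr0. Qed.

Lemma ansatz_derive u v : theta p v = 0 ->
  is_derive p u (fun q => ansatz phi PhiT q v)
    (ansatz_mx (dact_ln u) v + dtheta u v *: PhiT p).
Proof.
move=> tv.
have D00 : is_derive p u (act_ln (@V00 R) phi) (dact_ln u (@V00 R)).
  by rewrite V00E; exact: is_derive_act_ln.
have D10 : is_derive p u (act_ln (@V10 R) phi) (dact_ln u (@V10 R)).
  by rewrite V10E; exact: is_derive_act_ln.
have D01 : is_derive p u (act_ln (@V01 R) phi) (dact_ln u (@V01 R)).
  by rewrite V01E; exact: is_derive_act_ln.
have D11 : is_derive p u (act_ln (@V11 R) phi) (dact_ln u (@V11 R)).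
  by rewrite V11E; exact: is_derive_act_ln.
have DD := is_deriveZ 2^-1 (is_deriveB (is_derive_lin2 (v 0 0) (v 0 1) D00 D10)
  (is_derive_lin2 (v 0 2) (v 0 3) D01 D11)).
exact: (is_deriveD (is_derive_mx22 DD (is_derive_lin2 (v 0 0) (v 0 1) D01 D11)
  (is_derive_lin2 (v 0 2) (v 0 3) D00 D10) (is_deriveN DD)) (is_derive_theta u tv PhiTc)).
Qed.

(** The hypotheses say that [theta] vanishes on [u] and [v] and that its exterior derivative
    vanishes on the pair; this removes [PhiT] from the wedge term and from the derivative term. *)
Lemma curvature_ansatz u v : theta p u = 0 -> theta p v = 0 -> dtheta u v = dtheta v u ->
  let A := ansatz_mx (fun X => act_ln X phi p) in
  curvature (ansatz phi PhiT) p u v =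
  ansatz_mx (dact_ln u) v - ansatz_mx (dact_ln v) u + (A u *m A v - A v *m A u).
Proof.
move=> tu tv uv /=; rewrite /curvature /wedge_mx (ansatz_at tu) (ansatz_at tv).
congr (_ + _).
have [_ E1] := ansatz_derive u tv; have [_ E2] := ansatz_derive v tu.
apply: (etrans (congr2 (fun x y => x - y) E1 E2)).
by rewrite uv opprD addrACA subrr addr0.
Qed.

End Point.
End AnsatzCurvature.

(** * Vanishing of the curvature *)

Section PartOne.
Variable R : realType.
Local Notation C := (Cplx R).
Local Notation H := 'rV[Cplx R]_5.

Definition ansatz_val (x0 x1 x2 x3 a0 a1 a2 a3 : C) : 'M[C]_2 :=
  let D := 2^-1 * ((x0 * a0 + x1 * a1) - (x2 * a2 + x3 * a3)) in
  mx22 D (x2 * a0 + x3 * a1) (x0 * a2 + x1 * a3) (- D).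

Lemma ansatz_valE (A : @vfield R -> C) (v : H) (x0 x1 x2 x3 a0 a1 a2 a3 : C) :
  [/\ A (@V00 R) = x0, A (@V10 R) = x1, A (@V01 R) = x2 & A (@V11 R) = x3] ->
  [/\ v 0 0 = a0, v 0 1 = a1, v 0 2 = a2 & v 0 3 = a3] ->
  ansatz_mx A v = ansatz_val x0 x1 x2 x3 a0 a1 a2 a3.
Proof. by move=> [<- <- <- <-] [<- <- <- <-]. Qed.

(* [x_], [s_ab] are the first and iterated derivatives of [phi] along the frame,
   indexed 0, 1, 2, 3 for V00', V10', V01', V11'; [q0], [q1] are the spinor components. *)
Lemma asd_algebra (f x0 x1 x2 x3 s00 s01 s02 s03 s10 s11 s12 s13 s20 s21 s22 s23
    s30 s31 s32 s33 q0 q1 : C) :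
  f != 0 -> s10 = s01 -> s32 = s23 -> s20 = s02 -> s31 = s13 -> s03 = s12 -> s30 = s21 ->
  let a x := f^-1 * x in
  let du x s s' := - f ^- 2 * (q0 * x0 + - q1 * x2) * x + f^-1 * (q0 * s + - q1 * s') in
  let dv x s s' := - f ^- 2 * (q0 * x1 + - q1 * x3) * x + f^-1 * (q0 * s + - q1 * s') in
  let Au := ansatz_val (a x0) (a x1) (a x2) (a x3) q0 0 (- q1) 0 in
  let Av := ansatz_val (a x0) (a x1) (a x2) (a x3) 0 q0 0 (- q1) in
  ansatz_val (du x0 s00 s20) (du x1 s01 s21) (du x2 s02 s22) (du x3 s03 s23) 0 q0 0 (- q1) -
  ansatz_val (dv x0 s10 s30) (dv x1 s11 s31) (dv x2 s12 s32) (dv x3 s13 s33) q0 0 (- q1) 0 +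
  (Au *m Av - Av *m Au) = 0.
Proof.
move=> f0 -> -> -> -> -> ->; rewrite /ansatz_val !mx22M !mx22B !mx22D.
apply: mx22_eq0; field; exact: f0.
Qed.

Lemma VA0E (q0 q1 : C) (p : H) : VA0 q0 q1 p = q0 *: V00 p + (- q1) *: V01 p.
Proof. by rewrite scaleNr. Qed.

Lemma VA1E (q0 q1 : C) (p : H) : VA1 q0 q1 p = q0 *: V10 p + (- q1) *: V11 p.
Proof. by rewrite scaleNr. Qed.

Lemma hfield_coord (i k l : 'I_5) (s : C) (p : H) :
  hfield i s k p 0 l = (i == l)%:R + s * p 0 k * (4%R == l)%:R.
Proof. by rewrite /hfield /dcoord !mxE !eqxx /= ![l == _]eq_sym. Qed.

Lemma lin_coord (a b : C) (u v : H) l : (a *: u - b *: v) 0 l = a * u 0 l - b * v 0 l.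
Proof. by rewrite !mxE. Qed.

Lemma VA0_coord (q0 q1 : C) (p : H) :
  [/\ VA0 q0 q1 p 0 0 = q0, VA0 q0 q1 p 0 1 = 0, VA0 q0 q1 p 0 2 = - q1,
    VA0 q0 q1 p 0 3 = 0 & VA0 q0 q1 p 0 4 = - (q0 * p 0 3 + q1 * p 0 1)].
Proof.
rewrite /VA0 V00E V01E.
by split; rewrite lin_coord !hfield_coord /=; ring.
Qed.

Lemma VA1_coord (q0 q1 : C) (p : H) :
  [/\ VA1 q0 q1 p 0 0 = 0, VA1 q0 q1 p 0 1 = q0, VA1 q0 q1 p 0 2 = 0,
    VA1 q0 q1 p 0 3 = - q1 & VA1 q0 q1 p 0 4 = - (q0 * p 0 2 + q1 * p 0 0)].
Proof.
rewrite /VA1 V10E V11E.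
by split; rewrite lin_coord !hfield_coord /=; ring.
Qed.

Lemma theta_VA0 (q0 q1 : C) (p : H) : theta p (VA0 q0 q1 p) = 0.
Proof.
rewrite /theta /y00 /y01 /y10 /y11.
by have [-> -> -> -> ->] := VA0_coord q0 q1 p; ring.
Qed.

Lemma theta_VA1 (q0 q1 : C) (p : H) : theta p (VA1 q0 q1 p) = 0.
Proof.
rewrite /theta /y00 /y01 /y10 /y11.
by have [-> -> -> -> ->] := VA1_coord q0 q1 p; ring.
Qed.

Lemma dtheta_VA (q0 q1 : C) (p : H) :
  dtheta (VA0 q0 q1 p) (VA1 q0 q1 p) = dtheta (VA1 q0 q1 p) (VA0 q0 q1 p).
Proof.
move: (VA0 q0 q1 p) (VA0_coord q0 q1 p) (VA1 q0 q1 p) (VA1_coord q0 q1 p).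
by move=> u [u0 u1 u2 u3 _] v [v0 v1 v2 v3 _]; rewrite /dtheta u0 u1 u2 u3 v0 v1 v2 v3; ring.
Qed.

Lemma ansatz_ASD (U : set H) (phi : H -> C) (PhiT : H -> 'M[C]_2) : open U ->
  holomorphic_on U phi -> (forall p, U p -> phi p != 0) ->
  (forall p, U p -> sublaplacian phi p = 0) -> holomorphic_on U PhiT ->
  ASD U (ansatz phi PhiT).
Proof.
move=> Uo phiU phi0 lap PhiTU q0 q1 _ p Up.
have phiD : \forall q \near p, differentiable phi q.
  by apply: filterS (open_nbhs_nbhs (conj Uo Up)) => q; exact: phiU.
have f0 := phi0 p Up.
have PhiTc : {for p, continuous PhiT} by apply: differentiable_continuous; exact: PhiTU.
rewrite (curvature_ansatz phiD f0 PhiTc (theta_VA0 q0 q1 p) (theta_VA1 q0 q1 p)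
  (dtheta_VA q0 q1 p)).
have Lap : second_act phi p (@V00 R) (@V11 R) - second_act phi p (@V10 R) (@V01 R) = 0 := lap p Up.
have du X : (exists i s k, X = hfield i s k) -> dact_ln phi p (VA0 q0 q1 p) X =
    - (phi p) ^- 2 * (q0 * act (@V00 R) phi p + - q1 * act (@V01 R) phi p) * act X phi p +
    (phi p)^-1 * (q0 * second_act phi p (@V00 R) X + - q1 * second_act phi p (@V01 R) X).
  move=> [i [s [k ->]]]; rewrite /dact_ln VA0E.
  have E1 := is_derive_linear q0 (- q1) (V00 p) (V01 p) (nbhs_singleton phiD).
  have E2 := derive_act_lin phiD i s k (V00 p) (V01 p) q0 (- q1).
  exact: (congr2 (fun x y => - (phi p) ^- 2 * x * act (hfield i s k) phi p + (phi p)^-1 * y) E1 E2).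
have dv X : (exists i s k, X = hfield i s k) -> dact_ln phi p (VA1 q0 q1 p) X =
    - (phi p) ^- 2 * (q0 * act (@V10 R) phi p + - q1 * act (@V11 R) phi p) * act X phi p +
    (phi p)^-1 * (q0 * second_act phi p (@V10 R) X + - q1 * second_act phi p (@V11 R) X).
  move=> [i [s [k ->]]]; rewrite /dact_ln VA1E.
  have E1 := is_derive_linear q0 (- q1) (V10 p) (V11 p) (nbhs_singleton phiD).
  have E2 := derive_act_lin phiD i s k (V10 p) (V11 p) q0 (- q1).
  exact: (congr2 (fun x y => - (phi p) ^- 2 * x * act (hfield i s k) phi p + (phi p)^-1 * y) E1 E2).
have i00 : exists i s k, @V00 R = hfield i s k by exists 0, (-1), 3; exact: V00E.
have i10 : exists i s k, @V10 R = hfield i s k by exists 1, (-1), 2; exact: V10E.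
have i01 : exists i s k, @V01 R = hfield i s k by exists 2, 1, 1; exact: V01E.
have i11 : exists i s k, @V11 R = hfield i s k by exists 3, 1, 0; exact: V11E.
have comm0 i j (s s' : C) k k' : k != 4 -> k' != 4 -> j != k -> i != k' ->
    second_act phi p (hfield j s' k') (hfield i s k) =
    second_act phi p (hfield i s k) (hfield j s' k').
  move=> k4 k'4 /negPf jk /negPf ik; apply/eqP; rewrite -subr_eq0 (second_act_comm phiD)//.
  by rewrite jk ik !mulr0 subr0 mul0r.
have c1 : second_act phi p (@V10 R) (@V00 R) = second_act phi p (@V00 R) (@V10 R).
  by rewrite V00E V10E; exact: comm0.
have c2 : second_act phi p (@V11 R) (@V01 R) = second_act phi p (@V01 R) (@V11 R).
  by rewrite V01E V11E; exact: comm0.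
have c5 : second_act phi p (@V01 R) (@V00 R) = second_act phi p (@V00 R) (@V01 R).
  by rewrite V00E V01E; exact: comm0.
have c6 : second_act phi p (@V11 R) (@V10 R) = second_act phi p (@V10 R) (@V11 R).
  by rewrite V10E V11E; exact: comm0.
(* In the two noncommuting pairs each field has as its coefficient the coordinate that the other one
   differentiates, with opposite signs; hence both commutators give the same multiple of [T]. *)
have comm1 i j : j != 4 -> i != 4 ->
    second_act phi p (hfield j 1 i) (hfield i (-1) j) -
    second_act phi p (hfield i (-1) j) (hfield j 1 i) =
    (-1 - 1) * act (@VT R) phi p.
  move=> j4 i4; apply: (etrans (second_act_comm phiD i j (-1) 1 j4 i4)).
  by rewrite !eqxx !mulr1.
have c3 : second_act phi p (@V11 R) (@V00 R) - second_act phi p (@V00 R) (@V11 R) =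
    (-1 - 1) * act (@VT R) phi p.
  by rewrite V00E V11E; exact: comm1.
have c4 : second_act phi p (@V01 R) (@V10 R) - second_act phi p (@V10 R) (@V01 R) =
    (-1 - 1) * act (@VT R) phi p.
  by rewrite V10E V01E; exact: comm1.
have e1 : second_act phi p (@V00 R) (@V11 R) = second_act phi p (@V10 R) (@V01 R).
  by apply/eqP; rewrite -subr_eq0; apply/eqP.
have e2 : second_act phi p (@V11 R) (@V00 R) = second_act phi p (@V01 R) (@V10 R).
  have := etrans c3 (esym c4); rewrite e1; exact: addIr.
have [u0 u1 u2 u3 _] := VA0_coord q0 q1 p.
have [v0 v1 v2 v3 _] := VA1_coord q0 q1 p.
have uE := And4 u0 u1 u2 u3; have vE := And4 v0 v1 v2 v3.
have duE := And4 (du _ i00) (du _ i10) (du _ i01) (du _ i11).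
have dvE := And4 (dv _ i00) (dv _ i10) (dv _ i01) (dv _ i11).
have aE := And4 (erefl (act_ln (@V00 R) phi p)) (erefl (act_ln (@V10 R) phi p))
  (erefl (act_ln (@V01 R) phi p)) (erefl (act_ln (@V11 R) phi p)).
have Au := ansatz_valE (A := fun X => act_ln X phi p) aE uE.
have Av := ansatz_valE (A := fun X => act_ln X phi p) aE vE.
apply: (etrans (congr2 (fun x y => x + y)
  (congr2 (fun x y => x - y) (ansatz_valE duE vE) (ansatz_valE dvE uE))
  (congr2 (fun x y => x *m y - y *m x) Au Av))).
exact: (@asd_algebra _ _ _ _ _ _ _ _ _ _ _ _ _ _ _ _ _ _ _ _ _ _ _ f0 c1 c2 c5 c6 e1 e2).
Qed.

End PartOne.

(** * The fundamental solution *)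

Section FundamentalSolution.
Variable R : realType.
Local Notation C := (Cplx R).
Local Notation H := 'rV[Cplx R]_5.
Implicit Types (p q u : H).

Lemma normsqE p : normsq p = p 0 0 * p 0 3 - p 0 2 * p 0 1.
Proof.
rewrite /normsq (expand_det_row _ 0) !big_ord_recl big_ord0 /cofactor !det_mx11 !mxE /=.
by rewrite /y00 /y01 /y10 /y11; ring.
Qed.

Lemma differentiable_normsq p : differentiable (@normsq R) p.
Proof.
rewrite (_ : @normsq R = fun q : H => q 0 0 * q 0 3 - q 0 2 * q 0 1); last first.
  by apply/funext => q; exact: normsqE.
apply: differentiableB; apply: differentiableM; exact: differentiable_coord.
Qed.

Definition fundden (q : H) : C := normsq q ^+ 2 - tcoord q ^+ 2.

Lemma differentiable_fundden p : differentiable fundden p.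
Proof.
apply: differentiableB; last by apply: differentiableM; exact: differentiable_coord.
by apply: differentiableM; exact: differentiable_normsq.
Qed.

Lemma fundsolE : @fundsol R = fun q => (fundden q)^-1.
Proof. by apply/funext => q; rewrite /fundsol div1r. Qed.

Lemma differentiable_fundsol p : fundden p != 0 -> differentiable (@fundsol R) p.
Proof.
by move=> D0; rewrite fundsolE; exact: (differentiableV (differentiable_fundden p) D0).
Qed.

Lemma near_fundden p : fundden p != 0 -> \forall q \near p, fundden q != 0.
Proof.
move=> D0; have := differentiable_continuous (differentiable_fundden p).
by move=> /cvgr_neq0; apply.
Qed.

Lemma is_derive_normsq p u : is_derive p u (@normsq R)
  (u 0 0 * p 0 3 + p 0 0 * u 0 3 - (u 0 2 * p 0 1 + p 0 2 * u 0 1)).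
Proof.
rewrite (_ : @normsq R = fun q : H => q 0 0 * q 0 3 - q 0 2 * q 0 1); last first.
  by apply/funext => q; exact: normsqE.
exact: (is_deriveB (is_deriveMf (is_derive_coord p u 0) (is_derive_coord p u 3))
  (is_deriveMf (is_derive_coord p u 2) (is_derive_coord p u 1))).
Qed.

Lemma is_derive_fundden p u (n : C) : is_derive p u (@normsq R) n ->
  is_derive p u fundden (2 * (normsq p * n - tcoord p * u 0 4)).
Proof.
move=> Hn; have Ht := is_derive_coord p u 4.
have := is_deriveB (is_deriveMf Hn Hn) (is_deriveMf Ht Ht).
move=> /is_derive_eq; apply; rewrite /tcoord; ring.
Qed.

Lemma is_derive_fundsol p u (n : C) : fundden p != 0 -> is_derive p u (@normsq R) n ->
  is_derive p u (@fundsol R) (- fundden p ^- 2 * (2 * (normsq p * n - tcoord p * u 0 4))).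
Proof.
by move=> D0 Hn; rewrite fundsolE; exact: (is_deriveVf D0 (is_derive_fundden Hn)).
Qed.

(** [normsq] does not involve [t], so only the [dcoord i] part of the field contributes. *)
Lemma normsq_hfield p i k (s : C) : is_derive p (hfield i s k p) (@normsq R)
  ((i == 0)%:R * p 0 3 + p 0 0 * (i == 3)%:R - ((i == 2)%:R * p 0 1 + p 0 2 * (i == 1)%:R)).
Proof.
apply: is_derive_eq (is_derive_normsq p (hfield i s k p)) _.
by rewrite !hfield_coord /= !mulr0 !addr0.
Qed.

(** [V11] sends both [normsq] and [t] to [y00], which leaves the factor [normsq - t]. [V01] sends
    them to [- y10] and [y10], which leaves [normsq + t]. *)
Lemma act_V11_fundsol q : fundden q != 0 ->
  act (@V11 R) (@fundsol R) q =
    -2 * ((fundden q)^-1 * (fundden q)^-1 * (q 0 0 * (normsq q + -1 * q 0 4))).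
Proof.
move=> D0; rewrite /act V11E.
have [_ E] := is_derive_fundsol D0 (normsq_hfield q 3 0 1).
apply: (etrans E); rewrite hfield_coord /= /tcoord.
by field.
Qed.

Lemma act_V01_fundsol q : fundden q != 0 ->
  act (@V01 R) (@fundsol R) q =
    2 * ((fundden q)^-1 * (fundden q)^-1 * (q 0 1 * (normsq q + 1 * q 0 4))).
Proof.
move=> D0; rewrite /act V01E.
have [_ E] := is_derive_fundsol D0 (normsq_hfield q 2 1 1).
apply: (etrans E); rewrite hfield_coord /= /tcoord.
by field.
Qed.

(** The differentiated function is the common form of [V11] and [V01] applied to [fundsol], with
    [(c, s, k)] equal to [(-2, -1, 0)] and [(2, 1, 1)]. *)
Lemma is_derive_weighted p u (n m c s : C) (k : 'I_5) : fundden p != 0 ->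
  is_derive p u (@normsq R) n -> is_derive p u fundden m ->
  is_derive p u
    (fun q => c * ((fundden q)^-1 * (fundden q)^-1 * (q 0 k * (normsq q + s * q 0 4))))
    (c * ((- fundden p ^- 2 * m * (fundden p)^-1 + (fundden p)^-1 * (- fundden p ^- 2 * m)) *
    (p 0 k * (normsq p + s * p 0 4)) +
   (fundden p)^-1 * (fundden p)^-1 *
     (u 0 k * (normsq p + s * p 0 4) + p 0 k * (n + s * u 0 4)))).
Proof.
move=> D0 Hn Hm.
have HV := is_deriveVf D0 Hm.
have Hw := is_deriveD Hn (is_deriveZ s (is_derive_coord p u 4)).
exact: (is_deriveZ c (is_deriveMf (is_deriveMf HV HV) (is_deriveMf (is_derive_coord p u k) Hw))).
Qed.

Lemma sublaplacian_fundsol p : fundden p != 0 -> sublaplacian (@fundsol R) p = 0.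
Proof.
move=> D0; rewrite /sublaplacian.
(* A second derivative needs the closed forms on a whole neighbourhood, where the denominator stays
   nonzero. *)
have E11 : \forall q \near p,
    -2 * ((fundden q)^-1 * (fundden q)^-1 * (q 0 0 * (normsq q + -1 * q 0 4))) =
    act (@V11 R) (@fundsol R) q.
  by apply: filterS (near_fundden D0) => q q0; rewrite act_V11_fundsol.
have E01 : \forall q \near p,
    2 * ((fundden q)^-1 * (fundden q)^-1 * (q 0 1 * (normsq q + 1 * q 0 4))) =
    act (@V01 R) (@fundsol R) q.
  by apply: filterS (near_fundden D0) => q q0; rewrite act_V01_fundsol.
have N00 := normsq_hfield p 0 3 (-1); have N10 := normsq_hfield p 1 2 (-1).
have D00 := is_derive_fundden N00; have D10 := is_derive_fundden N10.
have [_ H1] := near_eq_is_derive E11 (is_derive_weighted (-2) (-1) 0 D0 N00 D00).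
have [_ H2] := near_eq_is_derive E01 (is_derive_weighted 2 1 1 D0 N10 D10).
rewrite {1}/act V00E; rewrite [X in _ - X]/act V10E.
apply: (etrans (congr2 (fun x y => x - y) H1 H2)).
move: D0; rewrite !hfield_coord /= /fundden /tcoord normsqE.
move: (p 0 0) (p 0 1) (p 0 2) (p 0 3) (p 0 4) => y0 y1 y2 y3 t D0.
by field.
Qed.

End FundamentalSolution.

Theorem theorem1p2 (R : realType) :
  (forall (U : set (heis R)) (phi : heis R -> Cplx R),
      open U ->
      holomorphic_on U phi ->
      (forall p, U p -> phi p != 0) ->
      (forall p, U p -> sublaplacian phi p = 0) ->
      forall PhiT : heis R -> 'M[Cplx R]_2,
        holomorphic_on U PhiT ->
        ASD U (ansatz phi PhiT))
  /\
  (let U := ~` [set p : heis R | normsq p ^+ 2 = tcoord p ^+ 2] in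
      holomorphic_on U (@fundsol R) /\
      (forall p, U p -> sublaplacian (@fundsol R) p = 0)).
Proof.
split=> [U phi Uo phiU phi0 lap PhiT PhiTU|U]; first exact: ansatz_ASD.
have den0 p : U p -> fundden p != 0.
  by move=> Up; rewrite subr_eq0; apply/eqP.
split=> p /den0 D0; [exact: differentiable_fundsol|exact: sublaplacian_fundsol].
Qed.
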